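(* Let $(M,Z)$ be a relative $C^1$ manifold and let $f\colon M\to[0,\infty)$ be a continuous function with zero locus $f^{-1}(0)=Z$ and of class $C^1$ on $M\setminus Z$. Let $p\in\partial Z$ be a simple nondegenerate point. Then the following assertions are equivalent: (1) The point $p$ is K\L{} nondegenerate. (2) The point $p$ is weakly K\L{} nondegenerate. (3) There exists a compact neighborhood $K$ of $p$ such that the upper semicontinuous function $$\alpha^K(t)=\frac{1}{\displaystyle\inf_{x\in f^{-1}(t)\cap K}|\nabla_x f|}$$ is in $L^1(0,\rho)$ for some $\rho>0$. (4) There exist an open neighborhood $U$ of $p$, a number $\rho>0$ and a continuous function $a\colon(0,\rho]\to(0,\infty)$ such that $f(U)\subset[0,\rho]$, $a^{-1}=1/a\in L^1(0,\rho)$ and $$|\nabla_x f|\geq a(f(x))\quad\text{for all }x\in U\setminus Z.$$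
   Context: Relative manifolds. A relative $C^k$ manifold ($k\geq 1$) is a pair $(M,Z)$ where $(M,d)$ is a connected, locally compact metric space (not necessarily complete), $Z\subset M$ is a nonempty, closed, proper subset, and $M\setminus Z$ is a $C^k$ manifold of dimension $n\geq1$. It is assumed that the restriction of $d$ to $M\setminus Z$ comes from a Riemannian metric on $M\setminus Z$; gradients and norms are taken with respect to this Riemannian metric. $\partial$ denotes topological boundary. Relative functions. A relative function $(A_1,B_1)\to(A_2,B_2)$ between pairs ($B_i\subset A_i$) is a map $A_1\to A_2$ sending $B_1$ into $B_2$ and $A_1\setminus B_1$ into $A_2\setminus B_2$. A relative $C^1$ function is a continuous relative function whose restriction to $A_1\setminus B_1$ is $C^1$ (so a relative $C^1$ function on $([0,\rho),\{0\})$ is continuous on $[0,\rho)$ and $C^1$ on $(0,\rho)$). Nondegeneracy notions for $p\in\partial Z$ with respect to $f$: - $p$ is simple nondegenerate if it has a neighborhood $U_p$ with $\nabla_x f\neq0$ for all $x\in U_p\setminus Z$. - $p$ is K\L{} nondegenerate if there exist $\rho>0$, an open neighborhood $U\subset M$ of $p$ and a relative $C^1$ function $\Psi\colon([0,\rho),\{0\})\to([0,\infty),\{0\})$ such that $\Psi'(t)>0$ for $t\in(0,\rho)$ and $|\nabla_x(\Psi\circ f)|\geq1$ for all $x\in f^{-1}((0,\rho))\cap U$. - A simple nondegenerate $p$ is weakly K\L{} nondegenerate if there exist $\rho>0$, an open neighborhood $U\subset M$ of $p$ and a relative function $\Psi\colon([0,\rho],\{0\})\to([0,\infty),\{0\})$,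 nondecreasing and absolutely continuous on $[0,\rho]$, such that $|\nabla_x(\Psi\circ f)|\geq1$ for all $x\in f^{-1}(D_\Psi)\cap U$, where $D_\Psi\subset(0,\rho)$ is the set of points of differentiability of $\Psi$ (so $\nabla_x(\Psi\circ f)=\Psi'(f(x))\nabla_xf$ there). Conventions: $\inf\emptyset=+\infty$, $1/\infty=0$, $1/0=+\infty$. *)

(* Defs.v *)
From HB Require Import structures.
From mathcomp Require Import all_boot all_order all_algebra.
From mathcomp Require Import all_classical all_reals all_analysis.

Set Implicit Arguments.
Unset Strict Implicit.
Unset Printing Implicit Defensive.

Import Order.TTheory GRing.Theory Num.Theory.
Import numFieldNormedType.Exports.

Local Open Scope classical_set_scope.
Local Open Scope ring_scope.

(* For finite-dimensional V, continuity of all directional derivatives is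
   continuity of the differential. *)
Definition C1_on {R : realType} {V W : normedModType R} (O : set V)
    (h : V -> W) : Prop :=
  forall u, O u ->
    differentiable h u /\ forall v, {for u, continuous (fun w => 'D_v h w)}.

(* A homeomorphism from the open set [chart_dom] onto an open subset of R^n;
   [chart_map] and [chart_inv] are arbitrary outside these sets. *)
Record chart (R : realType) (n : nat) (M : topologicalType) := Chart {
  chart_dom : set M ;
  chart_map :> M -> 'rV[R]_n ;
  chart_inv : 'rV[R]_n -> M ;
  chart_dom_open : open chart_dom ;
  chart_cod_open : open (chart_map @` chart_dom) ;
  chart_mapK : forall x, chart_dom x -> chart_inv (chart_map x) = x ;
  chart_map_continuous :
    forall x, chart_dom x -> {for x, continuous chart_map} ;
  chart_inv_continuous :
    forall x, chart_dom x -> {for chart_map x, continuous chart_inv} }.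

Definition chart_cod {R : realType} {n : nat} {M : topologicalType}
    (c : chart R n M) : set 'rV[R]_n := c @` chart_dom c.

(* A C^1 manifold structure of dimension n on the subset D of M (which is
   then open), given by an atlas and a choice of a chart at every point. *)
Record C1_manifold (R : realType) (n : nat) (M : topologicalType)
    (D : set M) := C1Manifold {
  atlas : set (chart R n M) ;
  chart_at : M -> chart R n M ;
  atlas_sub : forall c, atlas c -> chart_dom c `<=` D ;
  chart_at_atlas : forall x, D x -> atlas (chart_at x) ;
  chart_at_dom : forall x, D x -> chart_dom (chart_at x) x ;
  atlas_C1 : forall c c', atlas c -> atlas c' ->
    C1_on (c @` (chart_dom c `&` chart_dom c')) (c' \o chart_inv c) }.

(* Tangent vectors are row vectors of coordinates in a chart, so that the
   Jacobian of a change of charts acts on them by right multiplication. *)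
Record riemannian_metric (R : realType) (n : nat) (M : topologicalType)
    (D : set M) (X : C1_manifold R n D) := RiemannianMetric {
  metric_mx : chart R n M -> 'rV[R]_n -> 'M[R]_n ;
  metric_mx_sym : forall c u, atlas X c -> chart_cod c u ->
    (metric_mx c u)^T = metric_mx c u ;
  metric_mx_posdef : forall c u (v : 'rV[R]_n), atlas X c -> chart_cod c u ->
    v != 0 -> 0 < (v *m metric_mx c u *m v^T) 0 0 ;
  metric_mx_continuous : forall c u, atlas X c -> chart_cod c u ->
    {for u, continuous (metric_mx c)} ;
  metric_mx_change : forall c c' x, atlas X c -> atlas X c' ->
    chart_dom c x -> chart_dom c' x ->
    let J := 'J (c' \o chart_inv c) (c x) in
    metric_mx c (c x) = J *m metric_mx c' (c' x) *m J^T }.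

Section riemannian.
Context {R : realType} {n : nat} {M : topologicalType} {D : set M}
  {X : C1_manifold R n D} (g : riemannian_metric X).

Definition C1_fun (f : M -> R) : Prop :=
  forall c, atlas X c -> C1_on (chart_cod c) (f \o chart_inv c : _ -> R^o).

(* Norm of a tangent vector at x given by its coordinates in [chart_at X x]. *)
Definition tangent_norm (x : M) (v : 'rV[R]_n) : R :=
  let c := chart_at X x in
  Num.sqrt ((v *m metric_mx g c (c x) *m v^T) 0 0).

(* Coordinates g^{ij} d_j f of the gradient in [chart_at X x]. *)
Definition grad (f : M -> R) (x : M) : 'rV[R]_n :=
  let c := chart_at X x in
  (\row_j 'D_(delta_mx 0 j) (f \o chart_inv c : _ -> R^o) (c x))
    *m invmx (metric_mx g c (c x)).

Definition grad_norm (f : M -> R) (x : M) : R := tangent_norm x (grad f x).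

(* A C^1 curve [0, 1] -> D, extended to a C^1 curve on a neighborhood. *)
Definition C1_curve (y : R -> M) : Prop :=
  exists O : set R, [/\ open O, `[0, 1] `<=` O,
    forall t, O t -> D (y t) /\ {for t, continuous y} &
    forall c, atlas X c ->
      C1_on (O `&` y @^-1` chart_dom c : set R^o) (c \o y)].

Definition speed (y : R -> M) (t : R) : R :=
  tangent_norm (y t) ('D_1 (chart_at X (y t) \o y : R^o -> _) t).

Definition curve_length (y : R -> M) : \bar R :=
  (\int[@lebesgue_measure R]_(t in `[0%R, 1%R]) (speed y t)%:E)%E.

(* Piecewise C^1 curves are represented by lists of consecutive C^1 curves. *)
Fixpoint curve_chain (x : M) (s : seq (R -> M)) (z : M) : Prop :=
  if s is y :: s' then [/\ C1_curve y, y 0 = x & curve_chain (y 1) s' z]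
  else x = z.

Definition riemannian_dist (x z : M) : \bar R :=
  ereal_inf [set (\sum_(y <- s) curve_length y)%E
            | s in [set s | curve_chain x s z]].

End riemannian.

Arguments C1_fun {R n M D} X f.

(* The distance of M comes from g on M \ Z in the sense that every point of
   M \ Z has a neighborhood on which it equals the geodesic distance of g.
   Equality is not required globally: geodesic distances in M \ Z may exceed
   those in M, or be infinite when Z disconnects M. *)
Record relative_C1_manifold (R : realType) (n : nat) (M : metricType R)
    (Z : set M) := RelativeC1Manifold {
  rel_dim_gt0 : (0 < n)%N ;
  rel_connected : connected [set: M] ;
  rel_locally_compact : locally_compact [set: M] ;
  rel_nonempty : Z !=set0 ;
  rel_closed : closed Z ;
  rel_proper : Z != [set: M] ;
  rel_manifold :> C1_manifold R n (~` Z) ;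
  rel_metric : riemannian_metric rel_manifold ;
  rel_dist : forall x, ~ Z x -> exists U : set M,
    [/\ nbhs x U, U `<=` ~` Z &
        forall y z, U y -> U z ->
          riemannian_dist rel_metric y z = (mdist y z)%:E] }.

Definition relative_fun {T1 T2 : Type} (A1 B1 : set T1) (A2 B2 : set T2)
    (h : T1 -> T2) : Prop :=
  [/\ forall t, A1 t -> A2 (h t), forall t, B1 t -> B2 (h t) &
      forall t, (A1 `\` B1) t -> (A2 `\` B2) (h t)].

Definition relative_C1_fun {R : realType} (A1 B1 A2 B2 : set R)
    (h : R -> R) : Prop :=
  [/\ relative_fun A1 B1 A2 B2 h, {within A1, continuous h} &
      C1_on (A1 `\` B1 : set R^o) (h : R^o -> R^o)].

Definition absolutely_continuous_on {R : realType} (a b : R)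
    (h : R -> R) : Prop :=
  forall e : R, 0 < e -> exists2 d : R, 0 < d &
    forall (m : nat) (u v : 'I_m -> R),
      (forall i, [/\ a <= u i, u i <= v i & v i <= b]) ->
      trivIset [set: 'I_m] (fun i => `]u i, v i[%classic) ->
      \sum_(i < m) (v i - u i) < d ->
      \sum_(i < m) `|h (v i) - h (u i)| < e.

Definition upper_semicontinuous_on {R : realType} (A : set R)
    (h : R -> \bar R) : Prop :=
  forall t (b : R), A t -> (h t < b%:E)%E ->
    \forall s \near within A (nbhs t), (h s < b%:E)%E.

Definition boundary {T : topologicalType} (A : set T) : set T :=
  closure A `\` A°.

Section nondegeneracy.
Context {R : realType} {n : nat} {M : metricType R} {Z : set M}
  (X : relative_C1_manifold n Z) (f : M -> R) (p : M).

Definition simple_nondegenerate : Prop :=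
  exists2 U : set M, nbhs p U &
    forall x, (U `\` Z) x -> grad (rel_metric X) f x != 0.

Definition KL_nondegenerate : Prop :=
  exists (rho : R) (U : set M) (Psi : R -> R),
    [/\ 0 < rho, open U, U p,
        relative_C1_fun `[0, rho[ [set 0] `[0, +oo[ [set 0] Psi &
        (forall t, t \in `]0, rho[ -> 0 < 'D_1 (Psi : R^o -> R^o) t) /\
        (forall x, (f @^-1` `]0, rho[ `&` U) x ->
           1 <= grad_norm (rel_metric X) (Psi \o f) x)].

Definition weakly_KL_nondegenerate : Prop :=
  simple_nondegenerate /\
  exists (rho : R) (U : set M) (Psi : R -> R),
    [/\ 0 < rho, open U /\ U p,
        relative_fun `[0, rho] [set 0] `[0, +oo[ [set 0] Psi,
        {in `[0, rho] &, {homo Psi : s t / s <= t}} /\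
        absolutely_continuous_on 0 rho Psi &
        let D_Psi := [set t | (t \in `]0, rho[) /\
                              derivable (Psi : R^o -> R^o) t 1] in
        forall x, (f @^-1` D_Psi `&` U) x ->
          1 <= grad_norm (rel_metric X) (Psi \o f) x].

(* [inve] and [ereal_inf] follow the conventions inf set0 = +oo, 1/oo = 0
   and 1/0 = +oo. *)
Definition alpha (K : set M) (t : R) : \bar R :=
  ((ereal_inf [set (grad_norm (rel_metric X) f x)%:E
              | x in f @^-1` [set t] `&` K])^-1)%E.

End nondegeneracy.

(* Main.v *)
Require Import Defs.
From HB Require Import structures.
From mathcomp Require Import all_boot all_order all_algebra.
From mathcomp Require Import all_classical all_reals all_analysis.
From mathcomp Require Import measurable_realfun lra.

Set Implicit Arguments.
Unset Strict Implicit.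
Unset Printing Implicit Defensive.

Import Order.TTheory GRing.Theory Num.Theory.
Import numFieldNormedType.Exports.

Local Open Scope classical_set_scope.
Local Open Scope ring_scope.

(** Everything rests on comparing Psi'(f x) with 1 / |grad f| on the level sets
of f near p, because |grad (Psi o f)| = Psi'(f x) |grad f| ([grad_norm_comp]).

KL nondegeneracy implies the weak form: a nondecreasing function that is
continuous at the left end of an interval and Lipschitz away from it is
absolutely continuous ([nondecreasing_abs_cont]); the C^1 function Psi,
restricted to a smaller compact interval, is of this kind.

The weak form makes alpha integrable: on the level t its inequality says
alpha(t) <= Psi'(t) whenever Psi is differentiable at t, for any compact K
inside U. A nondecreasing absolutely continuous function is differentiable
almost everywhere with integrable derivative
([abs_cont_nondecreasing_ae_derivable]): its Stieltjes measure is dominated by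
the Lebesgue measure ([stieltjes_dominated]), hence has a Radon-Nikodym
density, and Psi is a primitive of that density, so that the Lebesgue
differentiation theorem applies.

If alpha is integrable, a continuous function a exists: simple nondegeneracy
makes alpha finite once K is small, and alpha is upper semicontinuous
([alpha_usc]), so 1 / max(1, alpha) is a positive lower semicontinuous function
with integrable reciprocal. Such a function has a positive continuous minorant
whose reciprocal is still integrable ([exists_continuous_minorant]), and this
minorant is the function a. It is obtained by infimal convolution with cones l
|s - t|: for a fixed slope l this gives a continuous minorant, the minorants
increase to the function as l grows, and a slope that varies continuously with
the point makes the error of the integral of the reciprocal summable over
dyadic shells around 0.

Such a function a gives back KL nondegeneracy: Psi(t) is the integral of 1 / a
over [0, t], of class C^1 on the open interval with Psi' = 1 / a
([continuous_bound_imp_KL]).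

Upper semicontinuity of alpha is lower semicontinuity of the infimum of |grad
f| over the fibres of f in a compact set ([fiber_inf_lsc]). It requires |grad
f| to be continuous off Z ([grad_norm_continuous]); since the gradient at x is
computed in a chart that depends on x, this in turn rests on the independence
of its norm from the chart ([conorm_sq_change]). *)

(** * Matrices *)

Lemma posdef_unitmx (F : fieldType) n (G : 'M[F]_n) :
  (forall v : 'rV[F]_n, v != 0 -> (v *m G *m v^T) 0 0 != 0) -> G \in unitmx.
Proof.
move=> Gpos; rewrite unitmxE unitfE; apply/det0P => -[v v0 vG].
by have := Gpos v v0; rewrite vG mul0mx mxE eqxx.
Qed.

Lemma cvg_mx_coord (T : Type) (F : set_system T) (FF : Filter F)
    (K : numFieldType) m n (h : T -> 'M[K]_(m, n)) (l : 'M[K]_(m, n)) :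
  (forall i j, h x i j @[x --> F] --> l i j) -> h @ F --> l.
Proof.
move=> hl; apply/cvg_ballP => e e0.
near=> x; split=> // i j; move: i j.
near: x; apply: filter_forall => i; apply: filter_forall => j.
have /cvg_ballP/(_ e e0) := hl i j; exact.
Unshelve. all: by end_near. Qed.

Lemma cvg_coord (T : Type) (F : set_system T) (FF : Filter F)
    (K : numFieldType) m n (h : T -> 'M[K]_(m, n)) (l : 'M[K]_(m, n)) i j :
  h @ F --> l -> h x i j @[x --> F] --> l i j.
Proof.
move=> hl; apply: (@cvg_comp _ _ _ h (fun A : 'M[K]_(m, n) => A i j) F (nbhs l)) => //.
exact: coord_continuous.
Qed.

Lemma cvg_mulmx (T : Type) (F : set_system T) (FF : Filter F)
    (K : numFieldType) m n p (h : T -> 'M[K]_(m, n)) (k : T -> 'M[K]_(n, p))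
    (a : 'M[K]_(m, n)) (b : 'M[K]_(n, p)) :
  h @ F --> a -> k @ F --> b -> h x *m k x @[x --> F] --> a *m b.
Proof.
move=> ha kb; apply: cvg_mx_coord => i j.
rewrite mxE; under eq_fun do rewrite mxE.
apply: (cvg_big (op := +%R)); first exact: add_continuous.
by move=> l _; apply: cvgM; exact: cvg_coord.
Qed.

Lemma cvg_det (T : Type) (F : set_system T) (FF : Filter F)
    (K : numFieldType) n (h : T -> 'M[K]_n) (a : 'M[K]_n) :
  h @ F --> a -> \det (h x) @[x --> F] --> \det a.
Proof.
move=> ha; apply: (cvg_big (op := +%R)); first exact: add_continuous.
move=> s _; apply: cvgM; first exact: cvg_cst.
apply: (@cvg_big K _ ( *%R ) 1); first exact: mul_continuous.
by move=> i _; exact: cvg_coord.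
Qed.

(** By Cramer's rule the inverse is a rational function of the entries. *)
Lemma cvg_invmx (T : Type) (F : set_system T) (FF : Filter F)
    (K : numFieldType) n (h : T -> 'M[K]_n) (a : 'M[K]_n) :
  (\forall x \near F, h x \in unitmx) -> a \in unitmx ->
  h @ F --> a -> invmx (h x) @[x --> F] --> invmx a.
Proof.
move=> hU aU ha; rewrite {2}/invmx aU.
suff : (\det (h x))^-1 *: \adj (h x) @[x --> F] --> (\det a)^-1 *: \adj a.
  apply: cvg_trans; apply: near_eq_cvg; near=> x.
  by rewrite /invmx ifT//; near: x.
apply: cvg_mx_coord => i j.
rewrite !mxE; under eq_fun do rewrite !mxE.
apply: cvgM.
  apply: cvgV; last exact: cvg_det.
  by move: aU; rewrite unitmxE unitfE.
apply: cvgM; first exact: cvg_cst.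
apply: cvg_det; apply: cvg_mx_coord => k l.
by rewrite !mxE; under eq_fun do rewrite !mxE; exact: cvg_coord.
Unshelve. all: by end_near. Qed.

Lemma invmx_mul (F : fieldType) n (A B : 'M[F]_n) :
  A \in unitmx -> B \in unitmx -> invmx (A *m B) = invmx B *m invmx A.
Proof.
move=> uA uB; have uAB : A *m B \in unitmx by rewrite unitmx_mul uA.
by apply: (can_inj (mulmxK uAB)); rewrite mulVmx// mulmxA mulmxKV// mulVmx.
Qed.

(** * The norm of the gradient in charts *)

Section gradient_in_charts.
Context {R : realType} {n : nat} {M : topologicalType} {D : set M}
  {X : C1_manifold R n D} (g : riemannian_metric X).
Implicit Types (f : M -> R) (c : chart R n M) (x : M).

Definition partials f c x : 'rV[R]_n :=
  \row_j 'D_(delta_mx 0 j) (f \o chart_inv c : _ -> R^o) (c x).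

(** The squared norm of the differential of f at x for the dual metric, read
in the chart c. Unlike the gradient, whose coordinates refer to the chart
selected at x, this can be followed in one fixed chart while x moves. *)
Definition conorm_sq f c x : R :=
  (partials f c x *m invmx (metric_mx g c (c x)) *m (partials f c x)^T) 0 0.

Lemma chart_codP c x : chart_dom c x -> chart_cod c (c x).
Proof. by move=> cx; exact: imageP. Qed.

Lemma metric_unitmx c x : atlas X c -> chart_dom c x ->
  metric_mx g c (c x) \in unitmx.
Proof.
move=> Xc cx; apply: posdef_unitmx => v v0.
by rewrite gt_eqF// metric_mx_posdef//; exact: chart_codP.
Qed.

Lemma invmx_metric_sym c x : atlas X c -> chart_dom c x ->
  (invmx (metric_mx g c (c x)))^T = invmx (metric_mx g c (c x)).
Proof.
by move=> Xc cx; rewrite trmx_inv metric_mx_sym//; exact: chart_codP.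
Qed.

Lemma grad_normE f x : D x ->
  grad_norm g f x = Num.sqrt (conorm_sq f (chart_at X x) x).
Proof.
move=> Dx; have Xc := chart_at_atlas X Dx; have cx := chart_at_dom X Dx.
rewrite /grad_norm /tangent_norm /grad -/(partials f _ x) /conorm_sq.
congr (Num.sqrt (_ 0 0)).
rewrite trmx_mul invmx_metric_sym// !mulmxA.
by rewrite mulmxKV// metric_unitmx.
Qed.

Lemma grad_norm_gt0 f x : D x -> grad g f x != 0 -> 0 < grad_norm g f x.
Proof.
move=> Dx g0; rewrite /grad_norm /tangent_norm sqrtr_gt0.
apply: metric_mx_posdef => //; first exact: chart_at_atlas.
by apply: chart_codP; exact: chart_at_dom.
Qed.

Lemma grad_norm_ge0 f x : 0 <= grad_norm g f x.
Proof. exact: sqrtr_ge0. Qed.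

(** Chain rule for the factorization of f o c^-1 through c', which holds near
c x because the domain of c' is open. *)
Lemma partials_change f c c' x : C1_fun X f ->
  atlas X c -> atlas X c' -> chart_dom c x -> chart_dom c' x ->
  partials f c x = partials f c' x *m ('J (c' \o chart_inv c) (c x))^T.
Proof.
move=> fC1 Xc Xc' cx c'x.
have dtr : differentiable (c' \o chart_inv c) (c x).
  by have [] := atlas_C1 Xc Xc' (imageP c (conj cx c'x)).
have df : differentiable (f \o chart_inv c' : _ -> R^o) (c' x).
  by have [] := fC1 _ Xc' (c' x) (chart_codP c'x).
have EE : \forall u \near c x,
  (f \o chart_inv c : _ -> R^o) u
  = ((f \o chart_inv c' : _ -> R^o) \o (c' \o chart_inv c)) u.
  have : \forall u \near c x, chart_dom c' (chart_inv c u).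
    apply: chart_inv_continuous => //; rewrite chart_mapK//.
    by apply: open_nbhs_nbhs; split => //; exact: chart_dom_open.
  by apply: filterS => u c'u /=; rewrite chart_mapK.
have df' : differentiable (f \o chart_inv c' : _ -> R^o)
    ((c' \o chart_inv c) (c x)) by rewrite /= chart_mapK.
apply/rowP => j; rewrite !mxE.
have e0 : (delta_mx 0 j : 'rV[R]_n) != 0.
  by apply/eqP => /rowP/(_ j)/eqP; rewrite !mxE !eqxx oner_eq0.
rewrite (near_eq_derive _ EE)//.
rewrite deriveE; last exact: differentiable_comp.
rewrite diff_comp//= chart_mapK//.
set J := 'J _ _; have -> : 'd (c' \o chart_inv c) (c x) (delta_mx 0 j) = row j J.
  by rewrite /J /jacobian rowE mul_rV_lin1.
rewrite [row j J]row_sum_delta linear_sum.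
apply: eq_bigr => k _; rewrite linearZ/= !mxE mulrC; congr (_ * _).
by rewrite -deriveE.
Qed.

(** With J the Jacobian of the change of charts, the row of partial derivatives
is multiplied by J^T and the metric becomes J G' J^T, so that the Jacobians
cancel. Invertibility of J follows from that of both metric matrices. *)
Lemma conorm_sq_change f c c' x : C1_fun X f ->
  atlas X c -> atlas X c' -> chart_dom c x -> chart_dom c' x ->
  conorm_sq f c x = conorm_sq f c' x.
Proof.
move=> fC1 Xc Xc' cx c'x.
rewrite /conorm_sq (partials_change fC1 Xc Xc' cx c'x).
have := metric_mx_change g Xc Xc' cx c'x => /=.
set J := 'J _ _; set p := partials f c' x.
have := metric_unitmx Xc cx; have := metric_unitmx Xc' c'x.
move: (metric_mx g c (c x)) (metric_mx g c' (c' x)) => G G' uG' uG GE.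
have uJ : J \in unitmx.
  by move: uG; rewrite GE unitmx_mul unitmx_mul -andbA => /and3P[].
congr (_ 0 0).
rewrite GE !invmx_mul ?unitmx_mul ?uJ ?uG' ?unitmx_tr//.
rewrite trmx_mul trmxK !mulmxA.
rewrite -[p *m J^T *m _]mulmxA mulmxV ?unitmx_tr// mulmx1.
by rewrite -[_ *m invmx J *m J]mulmxA mulVmx// mulmx1.
Qed.

Lemma grad_norm_chart f c x : C1_fun X f -> atlas X c -> chart_dom c x ->
  grad_norm g f x = Num.sqrt (conorm_sq f c x).
Proof.
move=> fC1 Xc cx; have Dx : D x := atlas_sub Xc cx.
rewrite (grad_normE f Dx).
have E := conorm_sq_change fC1 (chart_at_atlas X Dx) Xc (chart_at_dom X Dx) cx.
by rewrite E.
Qed.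

(** The chart selected at x covers a neighborhood of x, on which it computes
all the norms at once. *)
Lemma grad_norm_continuous f x : C1_fun X f -> D x ->
  {for x, continuous (grad_norm g f)}.
Proof.
move=> fC1 Dx; have := chart_at_atlas X Dx; have := chart_at_dom X Dx.
set c := chart_at X x => cx Xc.
have nc : \forall y \near x, chart_dom c y.
  by apply: open_nbhs_nbhs; split => //; exact: chart_dom_open.
have contc : c y @[y --> x] --> c x by exact: chart_map_continuous.
suff : Num.sqrt (conorm_sq f c y) @[y --> x] --> grad_norm g f x.
  apply: cvg_trans; apply: near_eq_cvg; near=> y.
  by rewrite (grad_norm_chart fC1 Xc)//; near: y.
rewrite (grad_norm_chart fC1 Xc cx).
apply: (@cvg_comp _ _ _ _ Num.sqrt _ (nbhs (conorm_sq f c x))); last exact: sqrt_continuous.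
have cp : partials f c y @[y --> x] --> partials f c x.
  apply: cvg_mx_coord => i j; rewrite mxE; under eq_fun do rewrite mxE.
  have [_ /(_ (delta_mx 0 j)) Hc] := fC1 _ Xc (c x) (chart_codP cx).
  exact: (@cvg_comp _ _ _ c ('D_(delta_mx 0 j) (f \o chart_inv c : _ -> R^o)) _ _ _ contc Hc).
rewrite /conorm_sq; apply: cvg_coord; apply: cvg_mulmx; last first.
  apply: cvg_mx_coord => i j; rewrite mxE; under eq_fun do rewrite mxE.
  exact: cvg_coord.
apply: cvg_mulmx => //; apply: cvg_invmx.
- by apply: filterS nc => y cy; exact: metric_unitmx.
- exact: metric_unitmx.
- have mc : {for c x, continuous (metric_mx g c)}.
    by apply: metric_mx_continuous => //; exact: chart_codP.
  exact: (@cvg_comp _ _ _ c (metric_mx g c) _ _ _ contc mc).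
Unshelve. all: by end_near. Qed.

Lemma grad_norm_comp f (h : R -> R) x : C1_fun X f -> D x ->
  derivable (h : R^o -> R^o) (f x) 1 ->
  grad_norm g (h \o f) x = `|'D_1 (h : R^o -> R^o) (f x)| * grad_norm g f x.
Proof.
move=> fC1 Dx dh; rewrite !grad_normE//.
have := chart_at_atlas X Dx; have := chart_at_dom X Dx.
set c := chart_at X x => cx Xc; set k := 'D_1 (h : R^o -> R^o) (f x).
suff E : partials (h \o f) c x = k *: partials f c x.
  rewrite /conorm_sq E.
  rewrite -sqrtr_sqr -sqrtrM ?sqr_ge0//.
  rewrite -scalemxAl -scalemxAl linearZ/= -scalemxAr scalerA mxE.
  by rewrite expr2.
apply/rowP => j; rewrite !mxE.
have df : differentiable (f \o chart_inv c : _ -> R^o) (c x).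
  by have [] := fC1 _ Xc (c x) (chart_codP cx).
have fcx : (f \o chart_inv c) (c x) = f x by rewrite /= chart_mapK.
have dh' : differentiable (h : R^o -> R^o) ((f \o chart_inv c : _ -> R^o) (c x)).
  by rewrite fcx; exact/derivable1_diffP.
rewrite deriveE; last exact: (differentiable_comp df dh').
rewrite (diff_comp df dh') /= chart_mapK//.
rewrite (deriv1E dh) derive1E -deriveE//.
by rewrite mulrC.
Qed.

End gradient_in_charts.

(** * Infima over the fibres of a function *)

Section infimum_on_fibers.
Context {R : realType} {T : topologicalType}.
Variables (f g : T -> R) (K : set T).
Hypotheses (T_hausdorff : hausdorff_space T) (K_compact : compact K)
  (f_cont : continuous f) (g_cont : forall x, 0 < f x -> {for x, continuous g}).

Definition fiber_inf (t : R) : \bar R :=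
  ereal_inf [set (g x)%:E | x in f @^-1` [set t] `&` K].

(** The strict inequality survives in the infimum because the fibre in K is
compact, so that the infimum is attained, or is +oo on an empty fibre. *)
Lemma fiber_inf_gt (t c : R) : 0 < t ->
  (forall x, f x = t -> K x -> c < g x) -> (c%:E < fiber_inf t)%E.
Proof.
move=> t0 cg; rewrite /fiber_inf.
have [->|/set0P S0] := eqVneq (f @^-1` [set t] `&` K) set0.
  by rewrite image_set0 ereal_inf0 ltry.
have Sc : compact (f @^-1` [set t] `&` K).
  apply: (subclosed_compact _ K_compact) => //.
  apply: closedI; last exact: compact_closed.
  by apply: preimage_closed => // x _; exact: f_cont.
have gS : {within f @^-1` [set t] `&` K, continuous g}.
  by apply: continuous_in_subspaceT => x /set_mem[/= fx _]; apply: g_cont; rewrite fx.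
have [x /set_mem[fx Kx] xmin] := compact_EVT_min S0 Sc gS.
apply: (@lt_le_trans _ _ (g x)%:E); first by rewrite lte_fin cg.
apply: le_ereal_inf_tmp => _ [y Sy <-]; rewrite lee_fin; apply: xmin; exact/mem_set.
Qed.

(** The points of K above a level near t at which g <= c form a compact set.
Its image under f is closed and does not contain t. *)
Lemma fiber_inf_lsc (t c : R) : 0 < t -> (c%:E < fiber_inf t)%E ->
  \forall s \near t, (c%:E < fiber_inf s)%E.
Proof.
move=> t0 ct.
have t2 : t / 2 < t by rewrite ltr_pdivrMr// ltr_pMr// ltr1n.
(* The bound t / 2 keeps S away from the zeros of f, where g may be
   discontinuous. *)
pose S := K `&` [set x | t / 2 <= f x /\ g x <= c].
have Scl : closed S.
  rewrite -openC openE => x nSx; rewrite /interior.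
  have Ko : open (~` K) by rewrite openC; exact: compact_closed.
  have [Kx|nKx] := pselect (K x); last first.
    have : nbhs x (~` K) by exact: open_nbhs_nbhs.
    by apply: filterS => y nKy [].
  have [fx|fx] := ltP (f x) (t / 2).
    have : nbhs x (f @^-1` [set u | u < t / 2]).
      by apply: f_cont; exact: lt_nbhsl.
    by apply: filterS => y /= fy [_ []]; rewrite leNgt fy.
  have gx : c < g x.
    by rewrite ltNge; apply/negP => gx; apply: nSx; split.
  have fx0 : 0 < f x by rewrite (lt_le_trans _ fx)// divr_gt0.
  have : nbhs x (g @^-1` [set u | c < u]).
    by apply: g_cont => //; exact: lt_nbhsr.
  by apply: filterS => y /= gy [_ [_]]; rewrite leNgt gy.
have fScl : closed (f @` S).
  apply: compact_closed; first exact: Rhausdorff.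
  apply: continuous_compact; last by apply: (subclosed_compact Scl K_compact) => x [].
  by apply: continuous_subspaceT => x; exact: f_cont.
have nt : nbhs t (~` (f @` S)).
  apply: open_nbhs_nbhs; split; first by rewrite openC.
  move=> [x [Kx [_ gx]] fx].
  have : (fiber_inf t <= (g x)%:E)%E by apply: ereal_inf_lbound; exists x.
  by move=> /(lt_le_trans ct); rewrite lte_fin ltNge gx.
near=> s.
have st : t / 2 < s by near: s; exact: lt_nbhsr.
have nSs : (~` (f @` S)) s by near: s.
apply: fiber_inf_gt => [|x fx Kx]; first by rewrite (lt_trans _ st)// divr_gt0.
rewrite ltNge; apply/negP => gx; apply: nSs; exists x => //.
by split => //; split => //; rewrite fx ltW.
Unshelve. all: by end_near. Qed.

End infimum_on_fibers.

(** * Absolute continuity of nondecreasing functions *)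

(** By monotonicity the open intervals with ends h (u i) and h (v i) are again
disjoint, and they lie between h a and h b: their lengths are compared with
the Lebesgue measure. *)
Lemma sum_increments_le (R : realType) (a b : R) (h : R -> R) (m : nat)
    (u v : 'I_m -> R) :
  a <= b -> {in `[a, b] &, {homo h : s t / s <= t}} ->
  (forall i, [/\ a <= u i, u i <= v i & v i <= b]) ->
  trivIset [set: 'I_m] (fun i => `]u i, v i[%classic) ->
  \sum_(i < m) (h (v i) - h (u i)) <= h b - h a.
Proof.
move=> ab hh uv tI.
have ua i : u i \in `[a, b].
  by have [? ? ?] := uv i; rewrite in_itv/=; apply/andP; split=> //; lra.
have va i : v i \in `[a, b].
  by have [? ? ?] := uv i; rewrite in_itv/=; apply/andP; split=> //; lra.
have aa : a \in `[a, b] by rewrite in_itv/= lexx.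
have bb : b \in `[a, b] by rewrite in_itv/= lexx ab.
pose F i : set R := `]h (u i), h (v i)[%classic.
have tF : trivIset [set: 'I_m] F.
  move=> i j _ _ [y []]; rewrite /F /= !in_itv/= => /andP[ui vi] /andP[uj vj].
  have lt_preim k l : h (u k) < h (v l) -> u k < v l.
    by apply: contraTT; rewrite -!leNgt => le; apply: hh.
  apply: tI => //.
  pose p := Num.max (u i) (u j); pose q := Num.min (v i) (v j).
  have pq : p < q.
    by rewrite lt_min !gt_max !lt_preim//; exact: (@lt_trans _ _ y).
  have [up qv] : (u i <= p /\ u j <= p) /\ (q <= v i /\ q <= v j).
    by rewrite !le_max !ge_min !lexx ?orbT.
  by exists ((p + q) / 2); split; rewrite /= in_itv/=; apply/andP; split; lra.
have mF i : measurable (F i) by exact: measurable_itv.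
have lenF i : @lebesgue_measure R (F i) = (h (v i) - h (u i))%:E.
  rewrite lebesgue_measure_itv/= lte_fin; case: ltP => [_|le]; first by rewrite EFinB.
  have -> : h (v i) = h (u i); last by rewrite subrr.
  by apply/eqP; rewrite eq_le le hh//; have [] := uv i.
rewrite -lee_fin -sumEFin.
under eq_bigr do rewrite -lenF.
rewrite -(measure_bigsetU_ord (@lebesgue_measure R) predT mF tF).
have -> : (h b - h a)%:E = @lebesgue_measure R `[h a, h b]%classic.
  rewrite lebesgue_measure_itv/= lte_fin; case: ltP => [_|le]; first by rewrite EFinB.
  by apply/eqP; rewrite eqe subr_eq0 eq_le le hh.
apply: le_measure; rewrite ?inE//.
  by apply: bigsetU_measurable => i _; exact: mF.
apply: (big_ind (fun A => A `<=` _)); first by [].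
  by move=> A B Ah Bh; rewrite subUset.
move=> i _ y; rewrite /F /= !in_itv/= => /andP[hy yh].
have := hh _ _ aa (ua i); have := hh _ _ (va i) bb.
by have [au uvi vb] := uv i => /(_ vb) ? /(_ au) ?; apply/andP; split; lra.
Qed.

(** Cut all the intervals at a point c close to a. The increments to the left
of c add up to at most h c - h a, and those to the right of c are controlled by
the Lipschitz constant on [c, b]. *)
Lemma nondecreasing_abs_cont (R : realType) (a b : R) (h : R -> R) :
  {in `[a, b] &, {homo h : s t / s <= t}} ->
  (forall e, 0 < e -> exists2 c, a < c <= b & h c - h a < e) ->
  (forall c, a < c <= b -> exists L,
    forall s t, c <= s -> s <= t -> t <= b -> h t - h s <= L * (t - s)) ->
  absolutely_continuous_on a b h.
Proof.
move=> hh ha hL e e0.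
have [c /andP[ac cb] hc] : exists2 c, a < c <= b & h c - h a < e / 2.
  by apply: ha; rewrite divr_gt0.
have [L hLc] : exists L,
    forall s t, c <= s -> s <= t -> t <= b -> h t - h s <= L * (t - s).
  by apply: hL; rewrite ac.
pose L' := `|L| + 1.
have L'0 : 0 < L' by rewrite ltr_wpDl.
(* L' is positive even when L is not. *)
exists (e / 2 / L') => [|m u v uv tI sd]; first by rewrite !divr_gt0.
pose u' i := Num.min (u i) c; pose v' i := Num.min (v i) c.
have inab x : a <= x -> x <= b -> x \in `[a, b] by move=> ? ?; rewrite in_itv/=; apply/andP.
have split_incr i : `|h (v i) - h (u i)| <= (h (v' i) - h (u' i)) + L' * (v i - u i).
  have [au uvi vb] := uv i.
  rewrite ger0_norm; last by rewrite subr_ge0 hh// inab//; lra.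
  have L'p s t : c <= s -> s <= t -> t <= b -> h t - h s <= L' * (t - s).
    move=> cs st tb; apply: (le_trans (hLc _ _ cs st tb)).
    rewrite ler_wpM2r ?subr_ge0// (le_trans (ler_norm L))//.
    by rewrite lerDl.
  have [vc|cv] := leP (v i) c.
    rewrite /v' /u' !min_l//; last exact: le_trans uvi vc.
    by rewrite lerDl mulr_ge0 ?subr_ge0// ltW.
  have [uc|cu] := leP (u i) c; rewrite /v' /u' (min_r (ltW cv)).
    rewrite min_l//.
    have := L'p _ _ (lexx c) (ltW cv) vb.
    have : L' * (v i - c) <= L' * (v i - u i) by rewrite (ler_wpM2l (ltW L'0))//; lra.
    lra.
  rewrite (min_r (ltW cu)) subrr add0r.
  by apply: L'p => //; exact: ltW.
apply: le_lt_trans (ler_sum _ (fun i _ => split_incr i)) _.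
rewrite big_split/= -mulr_sumr [e]splitr; apply: ltr_leD; last first.
  by rewrite mulrC -ler_pdivlMr// ltW.
apply: le_lt_trans hc; apply: sum_increments_le.
- exact: ltW.
- by move=> s t; rewrite !in_itv/= => /andP[? ?] /andP[? ?]; apply: hh; apply: inab => //; lra.
- move=> i; have [au uvi vb] := uv i; rewrite /u' /v'; split.
  + by rewrite le_min au ltW.
  + by rewrite le_min ge_min uvi/= ge_min lexx orbT.
  + by rewrite ge_min lexx orbT.
- move=> i j _ _ [y []]; rewrite /= !in_itv/= /u' /v' !gt_min !lt_min.
  move=> /andP[ui /andP[vi yc]] /andP[uj /andP[vj _]]; apply: tI => //.
  exists y; split; rewrite /= in_itv/= ?vi ?vj andbT.
    by case/orP: ui => //; rewrite ltNge ltW.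
  by case/orP: uj => //; rewrite ltNge ltW.
Qed.

(** * Almost everywhere differentiability *)

Section stieltjes_measure_of_absolutely_continuous.
Context {R : realType}.
Variables (F : cumulativeBounded (0 : R) (1 : R)) (a b : R).
Hypotheses (ab : a < b) (Fa : F a = 0) (Fb : F b = 1)
  (F_ac : absolutely_continuous_on a b F).

Let nu := lebesgue_stieltjes_measure F.
Let lambda := @lebesgue_measure R.

Lemma stieltjes_itv (u v : R) : u <= v -> nu `]u, v]%classic = (F v - F u)%:E.
Proof.
move=> uv; rewrite /nu /lebesgue_stieltjes_measure /measure_extension.
rewrite measurable_mu_extE/=; last exact: is_ocitv.
by rewrite wlength_itv_bnd.
Qed.

Lemma stieltjes_outside : nu (~` `]a, b]%classic) = 0%E.
Proof.
transitivity (1 - nu `]a, b]%classic)%E.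
  exact: (@probability_setC _ _ _ nu _ (measurable_itv _)).
by rewrite (stieltjes_itv (ltW ab)) Fa Fb subr0 subee.
Qed.

Let node (n i : nat) : R := a + i%:R * ((b - a) / n.+1%:R).

Let step_gt0 n : 0 < (b - a) / n.+1%:R.
Proof. by rewrite divr_gt0 ?subr_gt0 ?ltr0Sn. Qed.

Let node_lt n i : node n i < node n i.+1.
Proof. by rewrite /node ltrD2l ltr_pM2r// ltr_nat. Qed.

Let node_le n i j : (i <= j)%N -> node n i <= node n j.
Proof. by move=> ij; rewrite /node lerD2l ler_pM2r// ler_nat. Qed.

Let node0 n : node n 0 = a.
Proof. by rewrite /node mul0r addr0. Qed.

Let nodeS n : node n n.+1 = b.
Proof. by rewrite /node mulrC divfK ?pnatr_eq0// subrKC. Qed.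

(** The cell number i of the subdivision of ]a, b] into n + 1 equal parts is
kept when it lies in U, and is replaced by an empty interval otherwise: in this
way the cells contained in U form a family indexed by all i < n + 1, to which
the definition of absolute continuity applies. *)
Let right_end (U : set R) n i : R :=
  if `[< `]node n i, node n i.+1]%classic `<=` U >] then node n i.+1
  else node n i.

Let cell U n i : set R := `]node n i, right_end U n i]%classic.

Let cells U n : set R := \big[setU/set0]_(i < n.+1) cell U n i.

Let right_end_bounds U n i : node n i <= right_end U n i <= node n i.+1.
Proof. by rewrite /right_end; case: ifP; rewrite lexx ltW. Qed.

Let cell_sub U n i : cell U n i `<=` U.
Proof.
rewrite /cell /right_end; case: ifPn => [/asboolP//|_].
by rewrite set_itvoc0.
Qed.

Let cell_triv U n : trivIset [set: 'I_n.+1] (fun i => cell U n i).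
Proof.
have lt_disj i j x : (i < j)%N -> cell U n i x -> cell U n j x -> False.
  move=> ij; rewrite /cell /= !in_itv/= => /andP[_ xi] /andP[jx _].
  have /andP[_ ri] := right_end_bounds U n i.
  have := le_trans xi (le_trans ri (node_le n ij)).
  by rewrite leNgt jx.
move=> i j _ _ [x [xi xj]]; apply/val_inj/eqP.
by case: ltngtP => // ij; [case: (lt_disj _ _ _ ij xi xj)|case: (lt_disj _ _ _ ij xj xi)].
Qed.

Let cells_measurable U n : measurable (cells U n).
Proof. by apply: bigsetU_measurable => i _; exact: measurable_itv. Qed.

Let cells_measureE (mu : {measure set (measurableTypeR R) -> \bar R}) U n :
  mu (cells U n) = (\sum_(i < n.+1) mu (cell U n i))%E.
Proof.
apply: (@measure_bigsetU_ord _ _ _ mu _ predT (fun i => cell U n i)) => //.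
by move=> i; exact: measurable_itv.
Qed.

Let cells_sub U n : cells U n `<=` U.
Proof.
apply: (big_ind (fun A => A `<=` U)); first by [].
  by move=> A B AU BU; rewrite subUset.
by move=> i _; exact: cell_sub.
Qed.

Let cells_exhaust U x : open U -> U x -> `]a, b]%classic x ->
  exists N, forall n, (N <= n)%N -> cells U n x.
Proof.
move=> oU Ux; rewrite /= in_itv/= => /andP[ax xb].
have [e /= e0 eU] : nbhs_ball x U by apply/nbhs_ballP; apply: open_nbhs_nbhs.
exists (Num.truncn ((b - a) / e)).+1 => n Nn.
have step_lt : (b - a) / n.+1%:R < e.
  rewrite ltr_pdivrMr// mulrC -ltr_pdivrMr//.
  apply: (lt_le_trans (truncnS_gt _)).
  by rewrite ler_nat; exact: leq_trans Nn _.
have ex_node : exists j, x <= node n j by exists n.+1; rewrite nodeS.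
pose j := ex_minn ex_node.
have [xj jmin] : x <= node n j /\ forall i, x <= node n i -> (j <= i)%N.
  by rewrite /j; case: ex_minnP.
have j0 : (0 < j)%N.
  by rewrite lt0n; apply: contraTneq xj => ->; rewrite node0 -ltNge.
have jn : (j.-1 < n.+1)%N by rewrite prednK//; apply: jmin; rewrite nodeS.
have px : node n j.-1 < x.
  by rewrite ltNge; apply/negP => /jmin; rewrite -ltnS prednK// ltnn.
have gap : node n j - node n j.-1 < e.
  have -> : node n j = node n j.-1 + (b - a) / n.+1%:R.
    by rewrite -[in LHS](prednK j0) /node -natr1 mulrDl mul1r addrA.
  by rewrite addrC addKr.
have sub : `]node n j.-1, node n j.-1.+1]%classic `<=` U.
  move=> y; rewrite /= in_itv/= prednK// => /andP[py yj]; apply: eU.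
  by rewrite /ball/= ltr_norml; apply/andP; split; lra.
rewrite /cells (bigD1 (Ordinal jn))//=; left.
rewrite /cell /right_end /= ifT; last exact/asboolP.
by rewrite in_itv/= px prednK.
Qed.

(** A Lebesgue null set is contained in an open set U of small measure. Each
finite union of cells inside U then has small total length, hence measure at
most e for nu by absolute continuity; the part of U in ]a, b] is the increasing
union over m of the sets of points that lie in all the finite unions of index
at least m. *)
Lemma stieltjes_dominated : nu `<< lambda.
Proof.
apply/null_content_dominatesP => A mA A0.
apply/eqP; rewrite eq_le measure_ge0 andbT.
apply/lee_addgt0Pr => e e0; rewrite add0e.
have [d d0 Fd] := F_ac e0.
have [U [oU AU UAd]] : exists U, [/\ open U, A `<=` U & (lambda (U `\` A) < d%:E)%E].
  by apply: lebesgue_regularity_outer => //; rewrite [X in (X < _)%E]A0 ltry.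
have mU : measurable U by exact: open_measurable.
have Ud : (lambda U < d%:E)%E.
  rewrite -(setDUK AU); apply: le_lt_trans UAd.
  apply: (le_trans (measureU2 _ _ _)) => //; first exact: measurableD.
  by rewrite [X in (X + _)%E]A0 add0e.
have cell_nu n : (nu (cells U n) <= e%:E)%E.
  have -> : nu (cells U n) = (\sum_(i < n.+1) nu (cell U n i))%E.
    exact: (cells_measureE nu).
  under eq_bigr => i _.
    rewrite [nu _]stieltjes_itv; last by have /andP[] := right_end_bounds U n i.
    over.
  rewrite sumEFin lee_fin ltW//.
  have -> : \sum_(i < n.+1) (F (right_end U n i) - F (node n i)) =
            \sum_(i < n.+1) `|F (right_end U n i) - F (node n i)|.
    apply: eq_bigr => i _; rewrite ger0_norm// subr_ge0.
    by apply: cumulative_is_nondecreasing; have /andP[] := right_end_bounds U n i.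
  apply: Fd.
  - move=> i; have /andP[nr rn] := right_end_bounds U n i; split => //.
      by rewrite -(node0 n) node_le.
    by rewrite (le_trans rn)// -(nodeS n) node_le.
  - move=> i j _ _ [y [yi yj]]; apply: (@cell_triv U n) => //; exists y; split.
      by move: yi; rewrite /cell /= !in_itv/= => /andP[-> /ltW].
    by move: yj; rewrite /cell /= !in_itv/= => /andP[-> /ltW].
  - rewrite -lte_fin; apply: le_lt_trans Ud.
    rewrite -sumEFin.
    under eq_bigr => i _.
      have -> : (right_end U n i - node n i)%:E = lambda (cell U n i).
        rewrite /lambda /cell lebesgue_measure_itv/= lte_fin.
        have /andP[+ _] := right_end_bounds U n i.
        by rewrite le_eqVlt => /predU1P[->|->]; rewrite ?ltxx ?subrr// EFinB.
      over.
    have <- : lambda (cells U n) = (\sum_(i < n.+1) lambda (cell U n i))%E.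
      exact: (cells_measureE lambda).
    by apply: le_measure; rewrite ?inE; [exact: cells_measurable|exact: mU|exact: cells_sub].
(* The subdivisions are not nested; intersecting over n >= m makes the
   approximations increasing in m. *)
pose V m := \bigcap_(n in [set n | (m <= n)%N]) cells U n.
have mV m : measurable (V m) by apply: bigcap_measurableType => n _.
have V_nu m : (nu (V m) <= e%:E)%E.
  apply: le_trans (cell_nu m); apply: le_measure; rewrite ?inE.
  - exact: mV.
  - exact: cells_measurable.
  - by move=> y; apply => /=.
have mUV : measurable (\bigcup_m V m) by exact: bigcup_measurable.
have UV_nu : (nu (\bigcup_m V m) <= e%:E)%E.
  have ndV : nondecreasing_seq V.
    move=> m m' mm'; apply/subsetPset => y Vy n /= m'n; apply: Vy => /=.
    exact: leq_trans m'n.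
  have cv : nu (V m) @[m --> \oo] --> nu (\bigcup_m V m).
    exact: (@nondecreasing_cvg_mu _ _ _ nu _ mV mUV ndV).
  rewrite -(cvg_lim (@ereal_hausdorff R) cv).
  by apply: lime_le; [apply/cvg_ex; eexists; exact: cv|exact: nearW].
have mC : measurable (~` `]a, b]%classic : set (measurableTypeR R)).
  by apply: measurableC; exact: measurable_itv.
have AUV : A `<=` (\bigcup_m V m) `|` ~` `]a, b]%classic.
  move=> x Ax; have [xab|nxab] := pselect (`]a, b]%classic x); last by right.
  by left; have [N HN] := cells_exhaust oU (AU _ Ax) xab; exists N.
apply: (@le_trans _ _ (nu ((\bigcup_m V m) `|` ~` `]a, b]%classic))).
  apply: le_measure; rewrite ?inE; [exact: mA| |exact: AUV].
  exact: measurableU.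
apply: (le_trans (measureU2 nu mUV mC)).
by rewrite [X in (_ + X)%E]stieltjes_outside adde0.
Qed.

End stieltjes_measure_of_absolutely_continuous.

Lemma abs_cont_unif (R : realType) (a b : R) (h : R -> R) :
  absolutely_continuous_on a b h -> forall e, 0 < e -> exists2 d, 0 < d &
    forall s t, s \in `[a, b] -> t \in `[a, b] -> `|s - t| < d ->
      `|h s - h t| < e.
Proof.
move=> hac e e0; have [d d0 hd] := hac e e0; exists d => // s t.
wlog st : s t / t <= s.
  move=> H; have [|/ltW st sab tab] := leP t s; first exact: H.
  by rewrite distrC [X in X < e]distrC; exact: H.
rewrite !in_itv/= => /andP[as_ sb] /andP[at_ tb] std.
have := hd 1%N (fun=> t) (fun=> s); rewrite !big_ord1; apply.
- by move=> _; split.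
- by move=> i j _ _ _; rewrite (ord1 i) (ord1 j).
- by move: std; rewrite ger0_norm// subr_ge0.
Qed.

(** After extension by constants and normalization, h becomes the distribution
function of a probability measure dominated by the Lebesgue measure. Its
density is integrable, and h is up to constants the integral of this density,
so h is differentiable at every Lebesgue point. *)
Lemma abs_cont_nondecreasing_ae_derivable (R : realType) (a b : R) (h : R -> R) :
  a < b -> h a < h b -> {in `[a, b] &, {homo h : s t / s <= t}} ->
  absolutely_continuous_on a b h ->
  exists2 g : R -> R, (@lebesgue_measure R).-integrable setT (EFin \o g) &
    {ae @lebesgue_measure R, forall t, t \in `]a, b[ ->
      derivable (h : R^o -> R^o) t 1 /\ 'D_1 (h : R^o -> R^o) t = g t}.
Proof.
move=> ab hab hh hac.
pose cl t := Num.max a (Num.min t b).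
have cl_itv t : cl t \in `[a, b].
  by rewrite in_itv/= /cl le_max lexx/= ge_max (ltW ab) ge_min lexx orbT.
have cl_id t : t \in `[a, b] -> cl t = t.
  by rewrite in_itv/= => /andP[at_ tb]; rewrite /cl min_l// max_r.
have cl_homo s t : s <= t -> cl s <= cl t.
  by move=> st; rewrite /cl le_max2// le_min2.
have cl_lip s t : `|cl s - cl t| <= `|s - t|.
  wlog st : s t / t <= s.
    move=> H; have [|/ltW st] := leP t s; first exact: H.
    by rewrite distrC [leRHS]distrC; exact: H.
  rewrite !ger0_norm ?subr_ge0// ?cl_homo// /cl.
  by case: (leP s b) => ?; case: (leP t b) => ?; do ?case: (leP a _) => ?; lra.
pose C := h b - h a; have C0 : 0 < C by rewrite subr_gt0.
pose k t := (h (cl t) - h a) / C.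
have k_homo : {homo k : s t / s <= t}.
  move=> s t st; rewrite /k ler_pM2r ?invr_gt0// lerD2r.
  by apply: hh => //; exact: cl_homo.
have k_cont : continuous k.
  move=> t; apply/(@cvgrPdist_lt _ R^o) => e e0.
  have [d d0 hd] := abs_cont_unif hac (mulr_gt0 e0 C0).
  exists d => //= s; rewrite /ball_/= => ts.
  rewrite /k -mulrBl opprB addrA subrK normrM normfV (gtr0_norm C0) ltr_pdivrMr//.
  by apply: hd => //; exact: le_lt_trans (cl_lip _ _) ts.
have k_rc : right_continuous k by apply/right_continuousW.
have k_a t : t <= a -> k t = 0.
  by move=> ta; rewrite /k /cl max_l ?subrr ?mul0r// ge_min ta.
have k_b t : b <= t -> k t = 1.
  by move=> bt; rewrite /k /cl min_r// max_r ?ltW// divff// gt_eqF.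
have k_Ny : k @ -oo --> (0 : R).
  apply: cvg_near_cst; near=> t; apply: k_a; near: t; exact: (nbhs_ninfty_le (num_real a)).
have k_y : k @ +oo --> (1 : R).
  apply: cvg_near_cst; near=> t; apply: k_b; near: t; exact: (nbhs_pinfty_ge (num_real b)).
pose F : cumulativeBounded (0 : R) (1 : R) := HB.pack k
  (isCumulative.Build R _ R k k_homo k_rc)
  (isCumulativeBounded.Build R 0 1 k k_Ny k_y).
have F_ac : absolutely_continuous_on a b F.
  move=> e e0; have [d d0 hd] := hac (e * C) (mulr_gt0 e0 C0).
  exists d => // m u v uv tI sd.
  have -> : \sum_(i < m) `|F (v i) - F (u i)| =
            (\sum_(i < m) `|h (v i) - h (u i)|) / C.
    rewrite mulr_suml; apply: eq_bigr => i _ /=; have [? ? ?] := uv i.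
    rewrite /k -mulrBl opprB addrA subrK normrM normfV (gtr0_norm C0).
    by rewrite !cl_id// in_itv/=; apply/andP; split => //; lra.
  by rewrite ltr_pdivrMr//; exact: hd.
have Fa : F a = 0 by exact: k_a.
have Fb : F b = 1 by exact: k_b.
pose nu := lebesgue_stieltjes_measure F.
have dom := stieltjes_dominated ab Fa Fb F_ac.
pose chnu := charge_of_finite_measure nu.
have domc : chnu `<< @lebesgue_measure R by exact: dom.
pose ge := Radon_Nikodym chnu (@lebesgue_measure R).
have gint : (@lebesgue_measure R).-integrable setT ge by exact: Radon_Nikodym_integrable.
pose g := fine \o ge.
have gE : EFin \o g = ge.
  by apply/funext => t; rewrite /g /= fineK//; exact: Radon_Nikodym_fin_num.
have gint' : (@lebesgue_measure R).-integrable setT (EFin \o g) by rewrite gE.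
have kE t : t \in `[a, b] -> k t = (\int[@lebesgue_measure R]_(s in `]a, t]) g s)%R.
  rewrite in_itv/= => /andP[at_ tb].
  have E : (k t - k a)%:E = (\int[@lebesgue_measure R]_(s in `]a, t]) ge s)%E.
    transitivity (chnu `]a, t]%classic); first exact/esym/(stieltjes_itv F at_).
    exact: (Radon_Nikodym_integral domc (measurable_itv _)).
  move: E; rewrite [k a]k_a// subr0 /Rintegral -gE => E.
  by rewrite -[LHS]/(fine (k t)%:E) E.
exists (fun t => C * g t).
  have -> : EFin \o (fun t => C * g t) = (fun t => C%:E * (EFin \o g) t)%E.
    by apply/funext => t /=; rewrite EFinM.
  exact: integrableZl.
have glint : locally_integrable setT g.
  by apply: open_integrable_locally => //; exact: openT.
have gint_itv y : (@lebesgue_measure R).-integrable `]a, y] (EFin \o g).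
  by apply: integrableS gint' => //; exact: measurable_itv.
have := FTC1 gint_itv glint.
apply: filterS; first exact: (ae_filter_ringOfSetsType (@lebesgue_measure R)).
move=> t /= Ht tab.
have at_ : (BRight a < BRight t)%O by move: tab; rewrite in_itv/= bnd_simp => /andP[].
have [dG GE] := Ht at_.
set G := (fun y => _) in dG GE.
have near_h : \forall s \near t, C *: (G : R^o -> R^o) s + h a = h s.
  have : \forall s \near t, s \in `]a, b[ by exact: near_in_itvoo.
  apply: filterS => s sab.
  have sab' : s \in `[a, b] by exact: subset_itv_oo_cc.
  rewrite /G -kE// /k cl_id// -[_ *: _]/(C * _) mulrC divfK ?gt_eqF//.
  by rewrite subrK.
have dCG : derivable ((fun s => C *: (G : R^o -> R^o) s + h a) : R^o -> R^o) t 1.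
  by apply: derivableD; [exact: derivableZ|exact: derivable_cst].
split; first exact: near_eq_derivable near_h dCG.
rewrite -(near_eq_derive _ near_h).
rewrite deriveD; [|exact: derivableZ|exact: derivable_cst].
by rewrite deriveZ// derive_cst addr0 -derive1E GE.
Unshelve. all: by end_near. Qed.

(** * Continuous minorants of lower semicontinuous functions *)

Section infimal_convolution.
Context {R : realType}.
Variables (r : R) (A : R -> R).
Hypothesis A_ge0 : forall s, s \in `]0, r] -> 0 <= A s.

(** The Pasch-Hausdorff envelope of A on ]0, r]: its largest minorant that is
Lipschitz with constant l. *)
Definition inf_conv (l t : R) : R :=
  inf [set A s + l * `|s - t| | s in `]0, r]%classic].

Lemma inf_conv_le (l t s : R) : 0 <= l -> s \in `]0, r] ->
  inf_conv l t <= A s + l * `|s - t|.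
Proof.
move=> l0 sr; apply: ge_inf; last by exists s.
exists 0 => _ [s' s'r <-]; rewrite addr_ge0 ?mulr_ge0//.
exact: A_ge0.
Qed.

Lemma le_inf_conv (l t c : R) : 0 < r ->
  (forall s, s \in `]0, r] -> c <= A s + l * `|s - t|) -> c <= inf_conv l t.
Proof.
move=> r0 H; apply: lb_le_inf; last by move=> _ [s sr <-]; exact: H.
by exists (A r + l * `|r - t|); exists r => //=; rewrite in_itv/= r0 lexx.
Qed.

Lemma inf_conv_le_self (l t : R) : 0 <= l -> t \in `]0, r] -> inf_conv l t <= A t.
Proof.
by move=> l0 tr; have := inf_conv_le t l0 tr; rewrite subrr normr0 mulr0 addr0.
Qed.

Lemma inf_conv_homo (l l' t : R) : 0 < r -> 0 <= l -> l <= l' ->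
  inf_conv l t <= inf_conv l' t.
Proof.
move=> r0 l0 ll'; apply: le_inf_conv => // s sr.
by rewrite (le_trans (inf_conv_le t l0 sr))// lerD2l ler_wpM2r.
Qed.

(** The estimate is joint in the slope and the point, so that the slope can be
made a function of the point; see [inf_conv_continuous]. *)
Lemma inf_conv_lip (l l' t t' : R) : 0 < r -> 0 <= l -> t' \in `]0, r] ->
  inf_conv l t <= inf_conv l' t' + l * `|t - t'| + r * `|l - l'|.
Proof.
move=> r0 l0 t'r; rewrite -addrA -lerBlDr; apply: le_inf_conv => // s sr.
have st' : `|s - t'| <= r.
  move: sr t'r; rewrite !in_itv/= => /andP[s0 sr] /andP[t0 tr].
  by rewrite ler_norml; apply/andP; split; lra.
have := inf_conv_le t l0 sr.
have : l * `|s - t| <= l * `|s - t'| + l * `|t - t'|.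
  by rewrite -mulrDr ler_wpM2l// (distrC t) ler_distD.
have : (l - l') * `|s - t'| <= r * `|l - l'|.
  apply: (@le_trans _ _ (`|l - l'| * `|s - t'|)).
    by rewrite ler_wpM2r// ler_norm.
  by rewrite mulrC ler_wpM2r.
rewrite mulrBl; lra.
Qed.

(** Near t the values of A bound the convolution from below, and at distance d
or more from t the cone does. *)
Lemma inf_conv_ge (t c : R) : 0 < r ->
  (\forall s \near t, s \in `]0, r] -> c <= A s) ->
  exists2 d, 0 < d & forall l, 0 <= l -> Num.min c (l * d) <= inf_conv l t.
Proof.
move=> r0 /nbhs_ballP[d /= d0 dc]; exists d => // l l0.
apply: le_inf_conv => // s sr.
have [std|std] := ltP `|t - s| d.
  rewrite ge_min; apply/orP; left.
  by rewrite -[leLHS]addr0 lerD ?mulr_ge0//; exact: dc.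
rewrite ge_min; apply/orP; right.
by rewrite -[leLHS]add0r lerD ?A_ge0// distrC ler_wpM2l.
Qed.

Lemma inf_conv_gt0 (t l : R) : 0 < r -> 0 < l ->
  (exists2 c, 0 < c & \forall s \near t, s \in `]0, r] -> c <= A s) ->
  0 < inf_conv l t.
Proof.
move=> r0 l0 [c c0 /(inf_conv_ge r0)[d d0 H]].
by apply: lt_le_trans (H l (ltW l0)); rewrite lt_min c0 mulr_gt0.
Qed.

Lemma inf_conv_continuous (nu : R -> R) : 0 < r ->
  (forall t, t \in `]0, r] -> 0 <= nu t) ->
  {within `]0, r], continuous nu} ->
  {within `]0, r], continuous (fun t => inf_conv (nu t) t)}.
Proof.
move=> r0 nu0 cnu; apply/subspace_continuousP => t tr.
have /subspace_continuousP/(_ t tr) := cnu.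
set W := within _ _ => nut.
have idt : s @[s --> W] --> t by apply: cvg_within_filter.
apply/(@cvgrPdist_lt _ R^o) => e e0.
have bnd : (nu t + nu s) * `|t - s| + r * `|nu t - nu s| @[s --> W] --> (0 : R).
  rewrite [X in _ --> X](_ : 0 = (nu t + nu t) * `|t - t| + r * `|nu t - nu t|).
    apply: cvgD.
      apply: cvgM; first by apply: cvgD => //; exact: cvg_cst.
      by apply: (@cvg_norm _ R^o); apply: cvgB => //; exact: cvg_cst.
    apply: cvgM; first exact: cvg_cst.
    by apply: (@cvg_norm _ R^o); apply: cvgB => //; exact: cvg_cst.
  by rewrite !subrr normr0 !mulr0 addr0.
move/(@cvgrPdist_lt _ R^o)/(_ e e0) : bnd => bnd.
have Wr : \forall s \near W, s \in `]0, r] by exact: withinT.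
near=> s.
have sr : s \in `]0, r] by near: s.
have := inf_conv_lip (nu s) t r0 (nu0 t tr) sr.
have := inf_conv_lip (nu t) s r0 (nu0 s sr) tr.
rewrite (distrC s) (distrC (nu s)) => H1 H2.
have : `|0 - ((nu t + nu s) * `|t - s| + r * `|nu t - nu s|)| < e by near: s.
rewrite sub0r normrN; move/(le_lt_trans (ler_norm _)); apply: le_lt_trans.
have := mulr_ge0 (nu0 t tr) (normr_ge0 (t - s)).
have := mulr_ge0 (nu0 s sr) (normr_ge0 (t - s)).
by rewrite ler_norml => ? ?; apply/andP; split; lra.
Unshelve. all: by end_near. Qed.

End infimal_convolution.

Section continuous_minorant.
Context {R : realType}.
Local Notation mu := (@lebesgue_measure R).
Variables (r : R) (A : R -> R).
Hypotheses (r0 : 0 < r) (A_gt0 : forall t, t \in `]0, r] -> 0 < A t)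
  (A_lsc : forall t c, t \in `]0, r] -> c < A t ->
     \forall s \near t, s \in `]0, r] -> c < A s)
  (A_int : mu.-integrable `]0, r] (fun t => ((A t)^-1)%:E)).

Let A_ge0 s : s \in `]0, r] -> 0 <= A s.
Proof. by move=> /A_gt0/ltW. Qed.

Let locally_gt0 t : t \in `]0, r] ->
  exists2 c, 0 < c & \forall s \near t, s \in `]0, r] -> c <= A s.
Proof.
move=> tr; exists (A t / 2); first by rewrite divr_gt0 ?A_gt0.
have : A t / 2 < A t by rewrite ltr_pdivrMr// ltr_pMr ?A_gt0// ltr1n.
by move=> /(A_lsc tr); apply: filterS => s H /H /ltW.
Qed.

Let conv_gt0 l t : 0 < l -> t \in `]0, r] -> 0 < inf_conv r A l t.
Proof. by move=> l0 tr; apply: inf_conv_gt0 => //; exact: locally_gt0. Qed.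

Lemma inf_conv_cvg t : t \in `]0, r] -> inf_conv r A n.+1%:R t @[n --> \oo] --> A t.
Proof.
move=> tr; apply/(@cvgrPdist_lt _ R^o) => e e0.
have [d d0 H] : exists2 d, 0 < d &
    forall l, 0 <= l -> Num.min (A t - e / 2) (l * d) <= inf_conv r A l t.
  apply: inf_conv_ge => //.
  have : A t - e / 2 < A t by rewrite ltrBlDr ltrDl divr_gt0.
  by move=> /(A_lsc tr); apply: filterS => s K /K /ltW.
near=> n.
have An : A t / d < n.+1%:R.
  near: n; exists (Num.truncn (A t / d)) => // n /= Hn.
  by apply: (lt_le_trans (truncnS_gt _)); rewrite ler_nat ltnS.
have := inf_conv_le_self A_ge0 (ler0n R n.+1) tr.
have := H _ (ler0n R n.+1).
rewrite min_l; last first.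
  apply: (@le_trans _ _ (A t)); first by rewrite lerBlDr lerDl divr_ge0// ltW.
  by rewrite -ler_pdivrMr// ltW.
move=> ? ?; rewrite ltr_norml; apply/andP; split; lra.
Unshelve. all: by end_near. Qed.

Let sub_itv x y : 0 < x -> y <= r -> forall t, t \in `[x, y] -> t \in `]0, r].
Proof.
move=> x0 yr t; rewrite !in_itv/= => /andP[xt ty].
by rewrite (lt_le_trans x0 xt) (le_trans ty yr).
Qed.

Let conv_cont (l : R) : 0 <= l -> {within `]0, r], continuous (inf_conv r A l)}.
Proof.
move=> l0; apply: (inf_conv_continuous A_ge0 (nu := fun=> l)) => //.
by apply: continuous_subspaceT => t; exact: cvg_cst.
Qed.

Let inv_meas (f : R -> R) : (forall t, t \in `]0, r] -> 0 < f t) ->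
  {within `]0, r], continuous f} ->
  measurable_fun `]0, r] (fun t => ((f t)^-1)%:E).
Proof.
move=> f0 cf; apply/measurable_EFinP.
apply: subspace_continuous_measurable_fun => //; apply/subspace_continuousP => t tr.
apply: cvgV; first by rewrite gt_eqF// f0.
by move/subspace_continuousP : cf; exact.
Qed.

(** Dominated convergence: the reciprocals decrease to 1 / A, and on a compact
subinterval of ]0, r] the one of slope 1 is bounded. *)
Lemma approx_inv_integral x y e : 0 < x -> x < y -> y <= r -> 0 < e ->
  exists n, (\int[mu]_(t in `]x, y]) ((inf_conv r A n.+1%:R t)^-1)%:E <=
             \int[mu]_(t in `]x, y]) ((A t)^-1)%:E + e%:E)%E.
Proof.
move=> x0 xy yr e0.
have sub : `]x, y]%classic `<=` `]0, r]%classic.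
  by move=> t /subset_itv_oc_cc; exact: sub_itv.
have [c cxy cmin] : exists2 c, c \in `[x, y] &
    forall t, t \in `[x, y] -> inf_conv r A 1 c <= inf_conv r A 1 t.
  apply: EVT_min; first exact: ltW.
  apply: (@continuous_subspaceW _ _ _ `]0, r]); last exact: conv_cont.
  exact: sub_itv.
have c0 : 0 < inf_conv r A 1 c by apply: conv_gt0 => //; exact: sub_itv cxy.
have := @dominated_convergence _ _ _ mu `]x, y]%classic (measurable_itv _)
  (fun n t => ((inf_conv r A n.+1%:R t)^-1)%:E) (fun t => ((A t)^-1)%:E)
  (cst ((inf_conv r A 1 c)^-1)%:E).
case.
- move=> n; apply: measurable_funS sub _ => //; apply: inv_meas.
    by move=> t; exact: conv_gt0.
  exact: conv_cont.
- apply: measurable_funS sub _ => //.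
  exact: measurable_int A_int.
- apply: aeW => t txy.
  have tr : t \in `]0, r] by exact: sub.
  apply: cvg_EFin; first exact: nearW.
  by apply: cvgV; [rewrite gt_eqF// A_gt0|exact: inf_conv_cvg].
- apply/integrableP; split; first exact: measurable_cst.
  rewrite (_ : (fun _ => _) = cst (`|((inf_conv r A 1 c)^-1)%:E|)%E)//.
  by rewrite integral_cst//= lebesgue_measure_itv/= lte_fin xy -EFinB -EFinM ltry.
- apply: aeW => t n txy.
  have tr : t \in `]0, r] by exact: sub.
  have tn0 : 0 < inf_conv r A n.+1%:R t by exact: conv_gt0.
  rewrite /= lee_fin ger0_norm ?invr_ge0 ?(ltW tn0)// lef_pV2 ?posrE//.
  apply: (@le_trans _ _ (inf_conv r A 1 t)).
    by apply: cmin; exact: subset_itv_oc_cc.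
  by apply: inf_conv_homo => //; rewrite ler1n.
move=> Aint _ cv.
have Afin : (\int[mu]_(t in `]x, y]) ((A t)^-1)%:E)%E \is a fin_num.
  exact: integrable_fin_num.
move: cv; rewrite -(fineK Afin).
set I := fine _ => cv.
have nI : nbhs I%:E [set u : \bar R | (u < (I + e)%:E)%E].
  by apply: (@nbhs_open_ereal_lt _ I (fun z => z + e)); rewrite ltrDl.
have [n _ Hn] := cv _ nI.
by exists n; rewrite -EFinD ltW//; exact: (Hn n (leqnn n)).
Qed.

(** Ends of the dyadic shells ]bd k.+1, bd k] that make up ]0, r]. *)
Let bd (k : nat) : R := r / 2 ^+ k.

Let bd_gt0 k : 0 < bd k.
Proof. by rewrite divr_gt0// exprn_gt0. Qed.

Let bdS k : bd k.+1 < bd k.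
Proof. by rewrite ltr_pM2l// ltf_pV2 ?posrE ?exprn_gt0// ltr_eXn2l// ltr1n. Qed.

Let bd_le j k : (j <= k)%N -> bd k <= bd j.
Proof. by move=> jk; rewrite ler_pM2l// lef_pV2 ?posrE ?exprn_gt0// ler_eXn2l ?ltr1n. Qed.

Let bd_le_r k : bd k <= r.
Proof. by rewrite (le_trans (bd_le (leq0n k)))// /bd expr0 divr1. Qed.

Let shell (k : nat) : set R := `]bd k.+1, bd k]%classic.

Let ex_shell t : 0 < t -> exists k, bd k.+1 < t.
Proof.
move=> t0; exists (Num.truncn (r / t)).
rewrite /bd ltr_pdivrMr ?exprn_gt0// mulrC -ltr_pdivrMr//.
apply: (lt_le_trans (truncnS_gt _)).
by rewrite -natrX ler_nat ltnW// ltn_expl.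
Qed.

Let shell_idx (t : R) : nat :=
  if pselect (exists k, bd k.+1 < t) is left H then ex_minn H else 0.

Let shell_idx_gt t : 0 < t -> bd (shell_idx t).+1 < t.
Proof.
move=> /ex_shell H; rewrite /shell_idx; case: pselect => // {}H.
by case: ex_minnP.
Qed.

Let shell_idx_le t k : bd k.+1 < t -> (shell_idx t <= k)%N.
Proof.
move=> kt; rewrite /shell_idx; case: pselect => // H.
by case: ex_minnP => m _; apply.
Qed.

Let in_shell_idx t : t \in `]0, r] -> shell (shell_idx t) t.
Proof.
rewrite in_itv/= => /andP[t0 tr]; rewrite /shell /= in_itv/= shell_idx_gt//=.
case E : (shell_idx t) => [|k]; first by rewrite /bd expr0 divr1.
by rewrite leNgt; apply/negP => /shell_idx_le; rewrite E ltnn.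
Qed.

Let shell_idxE t k : shell k t -> shell_idx t = k.
Proof.
rewrite /shell /= in_itv/= => /andP[kt tk].
apply/eqP; rewrite eqn_leq shell_idx_le//= leqNgt; apply/negP => ik.
have t0 : 0 < t by exact: lt_trans kt.
have := shell_idx_gt t0; rewrite ltNge => /negP; apply.
by rewrite (le_trans tk)// bd_le.
Qed.

Let shell_sub k : shell k `<=` `]0, r]%classic.
Proof.
move=> t; rewrite /shell /= !in_itv/= => /andP[kt tk].
by rewrite (lt_trans _ kt)//= (le_trans tk).
Qed.

Let bigcup_shell : \bigcup_k shell k = `]0, r]%classic.
Proof.
apply/seteqP; split=> [t [k _]|t tr]; first exact: shell_sub.
by exists (shell_idx t) => //; exact: in_shell_idx.
Qed.

Let shell_triv : trivIset setT shell.
Proof. by move=> i j _ _ [t [/shell_idxE <- /shell_idxE <-]]. Qed.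

(** On the shell number k the slope n_ k makes the integral of the reciprocal
exceed that of 1 / A by at most 2^-(k+1), and any larger slope does as well. It
remains to find a continuous slope nu that is at least n_ k on the shell number
k: it is the reciprocal of an infimal convolution of the step function with
value 1 / n_ k there. *)
Theorem exists_continuous_minorant : exists a : R -> R,
  [/\ forall t, t \in `]0, r] -> 0 < a t,
      forall t, t \in `]0, r] -> a t <= A t,
      {within `]0, r], continuous a} &
      mu.-integrable `]0, r] (fun t => ((a t)^-1)%:E)].
Proof.
have e_gt0 k : (0 : R) < 1 / (2 ^ k.+1)%:R by rewrite divr_gt0// ltr0n expn_gt0.
have /choice[n_ n_P] := fun k =>
  approx_inv_integral (bd_gt0 k.+1) (bdS k) (bd_le_r k) (e_gt0 k).
pose B t : R := (n_ (shell_idx t)).+1%:R^-1.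
have B_gt0 t : 0 < B t by rewrite invr_gt0 ltr0n.
have B_ge0 t : t \in `]0, r] -> 0 <= B t by rewrite ltW.
pose m t := inf_conv r B 1 t.
have m_gt0 t : t \in `]0, r] -> 0 < m t.
  rewrite in_itv/= => /andP[t0 tr]; apply: inf_conv_gt0 => //.
  (* The points above t / 2 lie in the shells up to one after that of t. *)
  pose k := (shell_idx t).+1.
  exists ((\max_(i < k.+1) n_ i).+1%:R^-1); first by rewrite invr_gt0 ltr0n.
  have : t / 2 < t by rewrite ltr_pdivrMr// ltr_pMr// ltr1n.
  move=> /lt_nbhsr; apply: filterS => s ts sr.
  rewrite lef_pV2 ?posrE ?ltr0n// ler_nat ltnS.
  have sk : (shell_idx s < k.+1)%N.
    rewrite ltnS shell_idx_le// (lt_trans _ ts)//.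
    have := shell_idx_gt t0; rewrite -/k /bd exprS invfM mulrCA => kt.
    by rewrite mulrC ltr_pM2r.
  exact: (leq_bigmax (Ordinal sk)).
have m_cont : {within `]0, r], continuous m}.
  apply: (inf_conv_continuous B_ge0 (nu := fun=> 1)) => //.
  by apply: continuous_subspaceT => t; exact: cvg_cst.
pose nu t := (m t)^-1.
have nu_gt0 t : t \in `]0, r] -> 0 < nu t by move=> tr; rewrite invr_gt0 m_gt0.
have nu_ge t : t \in `]0, r] -> (n_ (shell_idx t)).+1%:R <= nu t.
  move=> tr; rewrite -[leLHS]invrK lef_pV2 ?posrE ?m_gt0 ?invr_gt0 ?ltr0n//.
  exact: inf_conv_le_self.
have nu_cont : {within `]0, r], continuous nu}.
  apply/subspace_continuousP => t tr; apply: cvgV; first by rewrite gt_eqF// m_gt0.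
  by move/subspace_continuousP : m_cont; exact.
pose a t := inf_conv r A (nu t) t.
have a_gt0 t : t \in `]0, r] -> 0 < a t.
  by move=> tr; apply: conv_gt0 => //; exact: nu_gt0.
have a_cont : {within `]0, r], continuous a}.
  by apply: inf_conv_continuous => // t tr; exact/ltW/nu_gt0.
exists a; split => //.
  by move=> t tr; apply: inf_conv_le_self => //; exact/ltW/nu_gt0.
have a_meas := inv_meas a_gt0 a_cont.
apply/integrableP; split => //.
under eq_integral => t /set_mem tr.
  rewrite gee0_abs ?lee_fin ?invr_ge0 ?(ltW (a_gt0 _ tr))//.
  over.
rewrite -bigcup_shell ge0_integral_bigcup; last 4 first.
- by move=> k; exact: measurable_itv.
- by rewrite bigcup_shell.
- by rewrite bigcup_shell => t tr; rewrite lee_fin invr_ge0 ltW// a_gt0.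
- exact: shell_triv.
have int_ge0 f k : (forall t, t \in `]0, r] -> 0 < f t) ->
    (0 <= \int[mu]_(t in shell k) ((f t)^-1)%:E)%E.
  move=> f0; apply: integral_ge0 => t tk.
  by rewrite lee_fin invr_ge0 ltW// f0//; exact: shell_sub tk.
apply: (@le_lt_trans _ _
  (\sum_(k <oo) (\int[mu]_(t in shell k) ((A t)^-1)%:E + (1 / (2 ^ k.+1)%:R)%:E))%E).
  apply: lee_nneseries => [k _ _|k _]; first exact: int_ge0.
  apply: le_trans (n_P k); apply: ge0_le_integral; first exact: measurable_itv.
  - by move=> t tk; rewrite lee_fin invr_ge0 ltW// a_gt0//; exact: shell_sub tk.
  - exact: measurable_funS (@shell_sub k) a_meas.
  - apply: measurable_funS (@shell_sub k) _ => //; apply: inv_meas.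
      by move=> t; exact: conv_gt0.
    exact: conv_cont.
  move=> t tk; have tr := shell_sub tk.
  rewrite lee_fin lef_pV2 ?posrE ?a_gt0 ?conv_gt0//.
  apply: inf_conv_homo => //.
  by have := nu_ge _ tr; rewrite (shell_idxE tk).
apply: (@le_lt_trans _ _ (\sum_(k <oo) \int[mu]_(t in shell k) ((A t)^-1)%:E + 1%:E)%E).
  by apply: epsilon_trick => // k; exact: int_ge0.
rewrite -ge0_integral_bigcup; last 4 first.
- by move=> k; exact: measurable_itv.
- by rewrite bigcup_shell; exact: measurable_int A_int.
- by rewrite bigcup_shell => t tr; rewrite lee_fin invr_ge0 ltW// A_gt0.
- exact: shell_triv.
rewrite bigcup_shell lte_add_pinfty ?ltry//.
rewrite -ge0_fin_numE; first exact: integrable_fin_num.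
by apply: integral_ge0 => t tr; rewrite lee_fin invr_ge0 ltW// A_gt0.
Qed.

End continuous_minorant.

(** * The four nondegeneracy conditions *)

Lemma compact_nbhs_sub (T : uniformType) (x : T) (U : set T) :
  locally_compact [set: T] -> nbhs x U ->
  exists K, [/\ compact K, nbhs x K & K `<=` U].
Proof.
move=> lc xU.
have [V xV [Vc Vcl]] := lc x I.
have [W xW WU] := uniform_regular xU.
exists (V `&` closure W); split.
- apply: (subclosed_compact _ Vc); last by move=> y [].
  by apply: closedI => //; exact: closed_closure.
- apply: filterI; first by move: xV; rewrite /within/=; apply: filterS => y; exact.
  by apply: filterS xW; exact: subset_closure.
- by move=> y [_ /WU].
Qed.

Section nondegeneracy_conditions.
Context {R : realType} {n : nat} {M : metricType R} {Z : set M}.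
Variables (X : relative_C1_manifold n Z) (f : M -> R).
Hypotheses (f_ge0 : forall x, 0 <= f x) (f_cont : continuous f)
  (f_zero : f @^-1` [set 0] = Z) (f_C1 : C1_fun X f).

Local Notation gn := (grad_norm (rel_metric X) f).
Local Notation mu := (@lebesgue_measure R).

Let M_hausdorff : hausdorff_space M. Proof. exact: metric_hausdorff. Qed.

Let f_gt0 x : 0 < f x <-> ~ Z x.
Proof.
rewrite -f_zero /=; split=> [fx0 fx|fx]; first by rewrite fx ltxx in fx0.
by rewrite lt_neqAle f_ge0 andbT eq_sym; apply/eqP.
Qed.

Let gn_cont x : 0 < f x -> {for x, continuous gn}.
Proof. by move=> /f_gt0 Zx; exact: grad_norm_continuous. Qed.

Lemma alphaE K t : alpha X f K t = ((fiber_inf f gn K t)^-1)%E.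
Proof. by []. Qed.

Let fiber_inf_ge0 K t : (0 <= fiber_inf f gn K t)%E.
Proof. by apply: le_ereal_inf_tmp => _ [x _ <-]; rewrite lee_fin grad_norm_ge0. Qed.

Lemma alpha_ge0 K t : (0 <= alpha X f K t)%E.
Proof. by rewrite alphaE inve_ge0. Qed.

Lemma alpha_lt K t b : 0 < b ->
  (alpha X f K t < b%:E)%E = ((b^-1)%:E < fiber_inf f gn K t)%E.
Proof.
move=> b0; rewrite alphaE inve_plt ?inE ?lee_fin ?(ltW b0)//.
by rewrite inver gt_eqF.
Qed.

Lemma alpha_usc K : compact K -> upper_semicontinuous_on `]0, +oo[ (alpha X f K).
Proof.
move=> Kc t b; rewrite /= in_itv/= andbT => t0 ab.
have b0 : 0 < b by rewrite -lte_fin (le_lt_trans (alpha_ge0 K t)).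
move: ab; rewrite alpha_lt// => /(fiber_inf_lsc M_hausdorff Kc f_cont gn_cont t0).
by move=> H; apply: filterS H => s; rewrite -alpha_lt.
Qed.

Lemma alpha_measurable K (r : R) : compact K -> measurable_fun `]0, r] (alpha X f K).
Proof.
move=> Kc; (* Extended by -oo off the open half-line, the opposite of alpha is lower
   semicontinuous on the whole line. *)
pose h t := if 0 < t then (- alpha X f K t)%E else -oo%E.
have h_lsc : lower_semicontinuous h.
  move=> t a; rewrite /h; case: ifPn => // t0; rewrite lteNr -EFinN => at_.
  have : \forall s \near t, s \in `]0, +oo[ -> (alpha X f K s < (- a)%:E)%E.
    by apply: (alpha_usc Kc) => //=; rewrite in_itv/= t0.
  move=> H; exists [set s | 0 < s /\ (alpha X f K s < (- a)%:E)%E].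
    apply: filterS2 H (lt_nbhsr t0) => s H s0; split => //.
    by apply: H; rewrite in_itv/= s0.
  by move=> s [-> sa]; rewrite lteNr -EFinN.
have := lower_semicontinuous_measurable h_lsc.
move=> /(measurable_funS measurableT (@subsetT _ `]0, r]%classic)) mh.
apply: (eq_measurable_fun (fun t => - h t)%E).
  by move=> t; rewrite inE/= in_itv/= /h => /andP[-> _]; rewrite oppeK.
exact: measurableT_comp.
Qed.

Lemma alpha_subset K K' t : K `<=` K' -> (alpha X f K t <= alpha X f K' t)%E.
Proof.
move=> KK'; rewrite !alphaE lee_pV2 ?inE ?fiber_inf_ge0//.
apply: le_ereal_inf_tmp => _ [x [fx Kx] <-].
by apply: ereal_inf_lbound; exists x => //; split => //; exact: KK'.
Qed.

Lemma alpha_fin_num K t : compact K -> 0 < t ->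
  (forall x, (K `\` Z) x -> grad (rel_metric X) f x != 0) ->
  alpha X f K t \is a fin_num.
Proof.
move=> Kc t0 gK; rewrite ge0_fin_numE ?alpha_ge0// ltey alphaE inve_eqy.
rewrite gt_eqF//; apply: (fiber_inf_gt M_hausdorff) => // x fx Kx.
have Zx : ~ Z x by apply/f_gt0; rewrite fx.
by apply: grad_norm_gt0 => //; exact: gK.
Qed.

Lemma alpha_ge K x : K x -> 0 < gn x -> ((gn x)^-1%:E <= alpha X f K (f x))%E.
Proof.
move=> Kx gx; rewrite alphaE -[leLHS](_ : (gn x)%:E^-1 = _)%E; last first.
  by rewrite inver gt_eqF.
rewrite lee_pV2 ?inE ?fiber_inf_ge0 ?lee_fin ?(ltW gx)//.
by apply: ereal_inf_lbound; exists x.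
Qed.

(** On [0, rho / 2] the function Psi is continuous up to 0, and its derivative
is bounded on every [c, rho / 2] with c > 0. *)
Lemma KL_imp_weakly_KL p : simple_nondegenerate X f p ->
  KL_nondegenerate X f p -> weakly_KL_nondegenerate X f p.
Proof.
move=> p_simple [rho [U [Psi [rho0 oU Up [relPsi Psi_cont Psi_C1] [dPsi gPsi]]]]].
split => //.
pose r := rho / 2.
have r0 : 0 < r by rewrite divr_gt0.
have rr : r < rho by rewrite ltr_pdivrMr// ltr_pMr// ltr1n.
have sub_co : `[0, r]%classic `<=` `[0, rho[%classic.
  by move=> t; rewrite /= !in_itv/= => /andP[-> tr]; exact: le_lt_trans tr rr.
have Psi_cr : {within `[0, r], continuous Psi}.
  exact: continuous_subspaceW sub_co Psi_cont.
have C1t t : 0 < t -> t < rho -> differentiable (Psi : R^o -> R^o) t /\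
    {for t, continuous (fun w : R^o => 'D_1 (Psi : R^o -> R^o) w)}.
  move=> t0 tr; have := Psi_C1 t; case.
    by split; [rewrite /= in_itv/= (ltW t0)|move=> /= tE; rewrite tE ltxx in t0].
  by move=> dif /(_ 1).
have dert t : 0 < t -> t < rho -> derivable (Psi : R^o -> R^o) t 1.
  by move=> t0 tr; apply/derivable1_diffP; have [] := C1t t t0 tr.
have Psi_homo : {in `[0, r] &, {homo Psi : s t / s <= t}}.
  apply: ger0_derive1_le_cc => // t; rewrite in_itv/= => /andP[t0 tr].
    by apply: dert => //; exact: lt_trans rr.
  by rewrite derive1E ltW// dPsi// in_itv/= t0/=; exact: lt_trans rr.
exists r, U, Psi; split => //.
- case: relPsi => rel1 rel2 rel3; split => // t.
    by move=> tr; apply: rel1; exact: sub_co.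
  by move=> [/sub_co tr t0]; exact: rel3.
- split => //; apply: nondecreasing_abs_cont => // [e e0|c /andP[c0 cr]].
    have /subspace_continuousP/(_ 0) := Psi_cr.
    rewrite /= in_itv/= lexx (ltW r0) => /(_ isT) /(@cvgrPdist_lt _ R^o)/(_ e e0).
    move=> /nbhs_ballP[d /= d0 dP].
    exists (Num.min r (d / 2)).
      by rewrite ge_min lexx andbT lt_min r0 divr_gt0.
    set c := Num.min _ _.
    have c0 : 0 < c by rewrite lt_min r0 divr_gt0.
    have cr : c <= r by rewrite ge_min lexx.
    have cd : c < d.
      by rewrite gt_min; apply/orP; right; rewrite ltr_pdivrMr// ltr_pMr// ltr1n.
    rewrite (le_lt_trans (ler_norm _))// distrC; apply: dP.
      by rewrite /ball/= sub0r normrN gtr0_norm.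
    by rewrite in_itv/= cr ltW.
  have [m _ mP] : exists2 m, m \in `[c, r] & forall t, t \in `[c, r] ->
      'D_1 (Psi : R^o -> R^o) t <= 'D_1 (Psi : R^o -> R^o) m.
    apply: EVT_max => //; apply: continuous_in_subspaceT => t /set_mem.
    rewrite /= in_itv/= => /andP[ct tr].
    by have [] := C1t t (lt_le_trans c0 ct) (le_lt_trans tr rr).
  exists ('D_1 (Psi : R^o -> R^o) m) => s t cs st tr.
  have [z zst ->] : exists2 z, z \in `[s, t] &
      Psi t - Psi s = 'D_1 (Psi : R^o -> R^o) z * (t - s).
    apply: (@MVT_segment R Psi (fun z => 'D_1 (Psi : R^o -> R^o) z)) => //.
      move=> z; rewrite in_itv/= => /andP[sz zt]; apply: DeriveDef => //.
      by apply: dert; lra.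
    apply: continuous_subspaceW Psi_cr => z; rewrite /= !in_itv/= => /andP[sz zt].
    by apply/andP; split; lra.
  apply: ler_wpM2r; first by rewrite subr_ge0.
  apply: mP; move: zst; rewrite !in_itv/= => /andP[sz zt].
  by apply/andP; split; lra.
- move=> D_Psi x [/= [fx _] Ux]; apply: gPsi; split => //=.
  by move: fx; rewrite !in_itv/= => /andP[-> fr]; exact: lt_trans rr.
Qed.

(** Where Psi is differentiable, the inequality bounds |grad f| from below by
1 / Psi'(t) on the whole fibre over t in a compact K inside U, so that
alpha(t) <= Psi'(t); and Psi' is almost everywhere equal to an integrable
function. *)
Lemma weakly_KL_imp_alpha_integrable p : locally_compact [set: M] ->
  weakly_KL_nondegenerate X f p ->
  exists K : set M, [/\ compact K, nbhs p K &
    exists2 rho : R, 0 < rho & mu.-integrable `]0, rho[ (alpha X f K)].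
Proof.
move=> lcM [_ [rho [U [Psi [rho0 [oU Up] [rel1 rel2 rel3] [Psi_homo Psi_ac] gPsi]]]]].
have [K [Kc pK KU]] : exists K, [/\ compact K, nbhs p K & K `<=` U].
  by apply: compact_nbhs_sub => //; exact: open_nbhs_nbhs.
exists K; split => //; exists rho => //.
have Psi0 : Psi 0 = 0 by exact: rel2.
have Psi_rho : Psi 0 < Psi rho.
  have [|/= + /eqP] := rel3 rho.
    by split; [rewrite /= in_itv/= ltW//=|move=> /= tE; rewrite tE ltxx in rho0].
  by rewrite in_itv/= andbT Psi0 lt_neqAle eq_sym => -> ->.
have [g gint gP] := abs_cont_nondecreasing_ae_derivable rho0 Psi_rho Psi_homo Psi_ac.
have amI : measurable_fun `]0, rho[ (alpha X f K).
  apply: (measurable_funS (measurable_itv `]0, rho])); last exact: alpha_measurable.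
  by move=> t; rewrite /= !in_itv/= => /andP[-> /ltW].
have gint' : mu.-integrable `]0, rho[ (EFin \o g).
  by apply: integrableS gint.
apply/integrableP; split => //.
have /integrableP[mg] := gint'; apply: le_lt_trans.
apply: ae_ge0_le_integral => //; do ?exact: measurableT_comp.
apply: filterS gP; first exact: (ae_filter_ringOfSetsType mu).
move=> t /= Ht tr; have [dt Dt] := Ht tr.
have t0 : 0 < t by move: tr; rewrite in_itv/= => /andP[].
rewrite gee0_abs ?alpha_ge0// alphaE.
have fib x : f x = t -> K x -> 1 <= `|g t| * gn x.
  move=> fx Kx; rewrite -Dt -fx -grad_norm_comp ?fx//.
    by apply: gPsi; split; [split; rewrite /= fx|exact: KU].
  by apply/f_gt0; rewrite fx.
have [gt0|] := ltP 0 `|g t|; last first.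
  move=> gt0; rewrite (_ : fiber_inf f gn K t = +oo%E) ?invey ?lee_fin//.
  rewrite /fiber_inf (_ : [set _ | _ in _] = set0) ?ereal_inf0//.
  apply/seteqP; split => // y [x [fx Kx] _].
  have := fib x fx Kx; rewrite leNgt => /negP; apply.
  by apply: (@le_lt_trans _ _ 0) => //; rewrite mulr_le0_ge0// grad_norm_ge0.
rewrite inve_ple ?inE ?fiber_inf_ge0 ?lee_fin// inver gt_eqF//.
apply: le_ereal_inf_tmp => _ [x [fx Kx] <-]; rewrite lee_fin.
by rewrite -[leLHS]mulr1 ler_pdivrMl//; exact: fib.
Qed.

Lemma integrable_cst_itv (k a b : R) : mu.-integrable `]a, b] (cst k%:E).
Proof.
apply: (@measurable_bounded_integrable _ _ _ mu (cst k)) => //.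
- rewrite [X in (X < _)%E]lebesgue_measure_itv/=.
  by case: ifP => _; rewrite ?ltry// -EFinB ltry.
- by exists `|k|; split; [exact: num_real|move=> x kx y _ /=; exact: ltW].
Qed.

(** Shrinking K decreases alpha, so K may be taken in the neighborhood where the
gradient does not vanish; then alpha is finite, and 1 / max(1, alpha) is real,
positive and lower semicontinuous. The maximum with 1 handles the empty fibres,
where alpha is 0, and costs only an integrable constant. *)
Lemma alpha_integrable_imp_continuous_bound p : locally_compact [set: M] ->
  Z p -> simple_nondegenerate X f p ->
  (exists K : set M, [/\ compact K, nbhs p K &
    exists2 rho : R, 0 < rho & mu.-integrable `]0, rho[ (alpha X f K)]) ->
  exists (U : set M) (rho : R) (a : R -> R),
    [/\ open U /\ U p, 0 < rho,
      (forall t, t \in `]0, rho] -> 0 < a t) /\ {within `]0, rho], continuous a},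
      f @` U `<=` `[0, rho] /\
        mu.-integrable `]0, rho[ (fun t => ((a t)^-1)%:E) &
      forall x, (U `\` Z) x -> a (f x) <= gn x].
Proof.
move=> lcM Zp [U0 pU0 U0g] [K0 [K0c pK0 [rho rho0 aint]]].
have [K1 [K1c pK1 K1U0]] := compact_nbhs_sub lcM pU0.
pose K := K0 `&` K1.
have pK : nbhs p K by exact: filterI.
have Kc : compact K.
  apply: (subclosed_compact _ K0c); last by move=> y [].
  by apply: closedI; exact: compact_closed.
have afin t : 0 < t -> alpha X f K t \is a fin_num.
  move=> t0; apply: alpha_fin_num => // x [[_ K1x] Zx]; apply: U0g.
  by split => //; exact: K1U0.
pose r := rho / 2.
have r0 : 0 < r by rewrite divr_gt0.
have rr : r < rho by rewrite ltr_pdivrMr// ltr_pMr// ltr1n.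
have sub_r : `]0, r]%classic `<=` `]0, rho[%classic.
  by move=> t; rewrite /= !in_itv/= => /andP[-> tr]; exact: le_lt_trans rr.
pose w t := Num.max 1 (fine (alpha X f K t)).
have w_gt0 t : 0 < w t by rewrite lt_max ltr01.
have wE t : 0 < t -> (w t)%:E = maxe 1%E (alpha X f K t).
  by move=> t0; rewrite -[in RHS](fineK (afin t t0)) -EFin_max.
have A_lsc t c : t \in `]0, r] -> c < (w t)^-1 ->
    \forall s \near t, s \in `]0, r] -> c < (w s)^-1.
  move=> tr ct; have t0 : 0 < t by move: tr; rewrite in_itv/= => /andP[].
  have [c0|c0] := leP c 0.
    by near=> s => _; rewrite (le_lt_trans c0)// invr_gt0.
  have wc s : (c < (w s)^-1) = (w s < c^-1).
    by rewrite -[in LHS](invrK c) ltf_pV2 ?posrE ?invr_gt0.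
  move: ct; rewrite wc -lte_fin wE// gt_max => /andP[c1 ac].
  have : \forall s \near t, s \in `]0, +oo[ -> (alpha X f K s < c^-1%:E)%E.
    by apply: (alpha_usc Kc) => //=; rewrite in_itv/= t0.
  apply: filterS => s sc; rewrite in_itv/= => /andP[s0 _].
  by rewrite wc -lte_fin wE// gt_max c1/= sc//= in_itv/= s0.
have A_int : mu.-integrable `]0, r] (fun t => (((w t)^-1)^-1)%:E).
  apply: (@le_integrable _ _ _ mu _ (measurable_itv _) _
    (fun t => 1%:E + alpha X f K0 t)%E).
  - apply: (eq_measurable_fun (fun t => maxe 1%E (alpha X f K t))).
      by move=> t; rewrite inE/= in_itv/= invrK => /andP[t0 _]; rewrite wE.
    by apply: measurable_maxe => //; exact: alpha_measurable.
  - move=> t; rewrite /= in_itv/= => /andP[t0 _]; rewrite invrK.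
    rewrite (ger0_norm (ltW (w_gt0 t))) wE//.
    rewrite gee0_abs; last by rewrite adde_ge0// alpha_ge0.
    rewrite ge_max leeDl ?alpha_ge0//=.
    rewrite (le_trans (alpha_subset (K' := K0) _ _))//; first by move=> y [].
    by rewrite leeDr.
  - apply: integrableD => //; first exact: integrable_cst_itv.
    exact: integrableS aint.
have A_gt0 t : t \in `]0, r] -> 0 < (w t)^-1 by rewrite invr_gt0.
have [a [a_gt0 a_le a_cont a_int]] := exists_continuous_minorant r0 A_gt0 A_lsc A_int.
have fp : f p = 0 by move: Zp; rewrite -f_zero.
have pf : nbhs p (f @^-1` [set u | u < r]).
  by apply: f_cont; rewrite fp; exact: lt_nbhsl.
pose U := (K `&` f @^-1` [set u | u < r])°.
have US : U `<=` K `&` f @^-1` [set u | u < r] by exact: interior_subset.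
exists U, r, a; split => //.
- split; first exact: open_interior.
  by apply: filterI.
- split.
    by move=> _ [x /US[_ /= fx] <-]; rewrite /= in_itv/= f_ge0 ltW.
  apply: integrableS a_int => //.
  by move=> t; rewrite /= !in_itv/= => /andP[-> /ltW].
- move=> x [/US[Kx fxr] Zx].
  have fx0 : 0 < f x by exact/f_gt0.
  have gx : 0 < gn x.
    by apply: grad_norm_gt0 => //; apply: U0g; split => //; apply: K1U0; case: Kx.
  apply: (le_trans (a_le (f x) _)); first by rewrite in_itv/= fx0 ltW.
  rewrite -[leRHS]invrK lef_pV2 ?posrE ?invr_gt0//.
  by rewrite -lee_fin wE// le_max; apply/orP; right; exact: alpha_ge.
Unshelve. all: by end_near. Qed.

(** Psi is the primitive of 1 / a that vanishes at 0. It is continuous there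
because 1 / a is integrable near 0. *)
Lemma continuous_bound_imp_KL p (U : set M) (rho : R) (a : R -> R) :
  open U -> U p -> 0 < rho -> (forall t, t \in `]0, rho] -> 0 < a t) ->
  {within `]0, rho], continuous a} ->
  mu.-integrable `]0, rho[ (fun t => ((a t)^-1)%:E) ->
  (forall x, (U `\` Z) x -> a (f x) <= gn x) ->
  KL_nondegenerate X f p.
Proof.
move=> oU Up rho0 a_gt0 a_cont a_int ag.
(* Restricting 1 / a makes it integrable on every [0, u], beyond rho as well. *)
pose b := (fun t => (a t)^-1) \_ `]0, rho[.
have bE t : t \in `]0, rho[ -> b t = (a t)^-1.
  by move=> tr; rewrite /b patchE mem_set.
have b_int : mu.-integrable setT (EFin \o b).
  rewrite /b -restrict_EFin.
  by rewrite -integrable_mkcond//; exact: measurable_itv.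
have sub_oc t : t \in `]0, rho[ -> t \in `]0, rho].
  by rewrite !in_itv/= => /andP[-> /ltW].
have b_gt0 t : t \in `]0, rho[ -> 0 < b t.
  by move=> tr; rewrite bE// invr_gt0 a_gt0// sub_oc.
have near_in t : t \in `]0, rho[ -> \forall s \near t, s \in `]0, rho[.
  by move=> tr; exact: near_in_itvoo.
have b_cont t : t \in `]0, rho[ -> {for t, continuous b}.
  move=> tr.
  have ac : {for t, continuous a}.
    have : {within `]0, rho[, continuous a}.
      by apply: continuous_subspaceW a_cont => s; exact: sub_oc.
    rewrite continuous_open_subspace; last exact: interval_open.
    by apply; exact/mem_set.
  suff : (a s)^-1 @[s --> t] --> b t.
    apply: cvg_trans; apply: near_eq_cvg; apply: filterS (near_in t tr) => s sr.
    by rewrite bE.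
  by rewrite bE//; apply: cvgV => //; rewrite gt_eqF// a_gt0// sub_oc.
pose Psi t := (\int[mu]_(s in `[0, t]) b s)%R.
have b_int' u : mu.-integrable `[0, u] (EFin \o b) by apply: integrableS b_int.
have dPsi t : t \in `]0, rho[ ->
    derivable (Psi : R^o -> R^o) t 1 /\ 'D_1 (Psi : R^o -> R^o) t = b t.
  move=> tr; have t0 : 0 < t by move: tr; rewrite in_itv/= => /andP[].
  have t1 : t < t + 1 by rewrite ltrDl.
  have := continuous_FTC1_closed t1 (b_int' (t + 1)) t0 (b_cont t tr).
  by rewrite derive1E.
have Psi0 : Psi 0 = 0.
  by rewrite /Psi set_itv1 Rintegral_set1.
have Psi_cont : {within `[0, rho[, continuous Psi}.
  apply/subspace_continuousP => t; rewrite /= in_itv/= => /andP[t0 tr].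
  apply: cvg_within_filter.
  move: t0; rewrite le_eqVlt => /predU1P[<-|t0].
    have : Psi x @[x --> (0 : R)] --> Psi 0.
      by rewrite Psi0; apply: (parameterized_integral_cvg_left (b := 1)).
    exact.
  have [dt _] : derivable (Psi : R^o -> R^o) t 1 /\ 'D_1 (Psi : R^o -> R^o) t = b t.
    by apply: dPsi; rewrite in_itv/= t0.
  exact/differentiable_continuous/derivable1_diffP.
have Psi_gt0 t : 0 < t -> t < rho -> 0 < Psi t.
  move=> t0 tr; rewrite -Psi0; apply: (@gtr0_derive1_lt_co _ Psi 0 rho) => //.
  - by move=> s sr; have [] := dPsi s sr.
  - by move=> s sr; have [_] := dPsi s sr; rewrite derive1E => ->; exact: b_gt0.
  - by rewrite in_itv/= lexx.
  - by rewrite in_itv/= tr ltW.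
exists rho, U, Psi; split => //.
- split => //.
  + split => [t|_ /= ->|t []] //=; rewrite ?in_itv/= ?andbT.
    * move=> /andP[]; rewrite le_eqVlt => /predU1P[<- _|t0 tr]; first by rewrite Psi0.
      by rewrite ltW// Psi_gt0.
    * move=> /andP[t0 tr] /eqP tn0.
      have Pt : 0 < Psi t by apply: Psi_gt0 => //; rewrite lt_neqAle eq_sym tn0.
      by split; [rewrite ltW|move=> PtE; rewrite PtE ltxx in Pt].
  + move=> t [/= + /eqP tn0]; rewrite in_itv/= => /andP[t0 tr].
    have t1 : 0 < t by rewrite lt_neqAle eq_sym tn0.
    have tt : t \in `]0, rho[ by rewrite in_itv/= t1.
    have difs s : s \in `]0, rho[ -> differentiable (Psi : R^o -> R^o) s.
      by move=> sr; apply/derivable1_diffP; have [] := dPsi s sr.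
    split => [|v]; first exact: difs.
    have DvE s : s \in `]0, rho[ -> 'D_v (Psi : R^o -> R^o) s = v * b s.
      move=> sr; have [_ <-] := dPsi s sr.
      rewrite deriveE; last exact: difs.
      by rewrite (deriv1E (dPsi s sr).1) derive1E.
    suff : v * b s @[s --> t] --> 'D_v (Psi : R^o -> R^o) t.
      apply: cvg_trans; apply: near_eq_cvg; apply: filterS (near_in t tt) => s sr.
      by rewrite DvE.
    by rewrite DvE//; apply: cvgM; [exact: cvg_cst|exact: b_cont].
- split => [t tr|x [/= fx Ux]]; first by rewrite (dPsi t tr).2 b_gt0.
  have [dx Dx] := dPsi _ fx.
  have fx0 : 0 < f x by move: fx; rewrite in_itv/= => /andP[].
  have Zx : ~ Z x by exact/f_gt0.
  rewrite grad_norm_comp// Dx (ger0_norm (ltW (b_gt0 _ fx))) bE//.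
  have afx : 0 < a (f x) by rewrite a_gt0// sub_oc.
  by rewrite ler_pdivlMl// mulr1; exact: ag.
Qed.

End nondegeneracy_conditions.

Theorem theorem3 (R : realType) (n : nat) (M : metricType R) (Z : set M)
    (X : relative_C1_manifold n Z) (f : M -> R)
    (f_ge0 : forall x, 0 <= f x)
    (f_cont : continuous f)
    (f_zero : f @^-1` [set 0] = Z)
    (f_C1 : C1_fun X f)
    (p : M) (p_bd : boundary Z p)
    (p_simple : simple_nondegenerate X f p) :
  (forall K : set M, compact K -> nbhs p K ->
     upper_semicontinuous_on `]0, +oo[ (alpha X f K)) /\
  [<-> KL_nondegenerate X f p;
       weakly_KL_nondegenerate X f p;
       exists K : set M, [/\ compact K, nbhs p K &
         exists2 rho : R, 0 < rho &
           (@lebesgue_measure R).-integrable `]0, rho[ (alpha X f K)];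
       exists (U : set M) (rho : R) (a : R -> R),
         [/\ open U /\ U p,
             0 < rho,
             (forall t, t \in `]0, rho] -> 0 < a t) /\
             {within `]0, rho], continuous a},
             f @` U `<=` `[0, rho] /\
             (@lebesgue_measure R).-integrable `]0, rho[
               (fun t => ((a t)^-1)%:E) &
             forall x, (U `\` Z) x ->
               a (f x) <= grad_norm (rel_metric X) f x]].
Proof.
have lcM := rel_locally_compact X.
have Zp : Z p.
  by case: p_bd => + _; have /closure_id <- := rel_closed X.
split; first by move=> K Kc _; exact: alpha_usc.
tfae.
- exact: KL_imp_weakly_KL.
- exact: weakly_KL_imp_alpha_integrable.
- exact: alpha_integrable_imp_continuous_bound.
- move=> [U [rho [a [[oU Up] rho0 [a_gt0 a_cont] [_ a_int] ag]]]].
  exact: (continuous_bound_imp_KL f_ge0 f_zero f_C1 oU Up rho0 a_gt0).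
Qed.
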